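(* Consider a network of $N$ non-redundant Euler–Lagrange systems with joint-space dynamics $$M_i(q_i)\ddot q_i+C_i(q_i,\dot q_i)\dot q_i+g_i(q_i)=J_i^{\mathsf T}(q_i)f_i,\qquad i=1,\dots,N,$$ with bounded task-space actuation $|f_i^k|\le \bar f_i^k$ ($k=1,\dots,n$), satisfying the standing properties and assumptions (including A.1–A.4) listed in the context. Let $x_i$ be the end-effector configuration of system $i$, $x_{ij}=x_i-x_j$, let $\mathcal N_i(0)$ be the initial neighbour set of system $i$ and $\mathcal E(0)$ the initial edge set, and let $\psi$ be the potential function described in the context, with parameter $Q>0$ and gradient bound $\sigma$. Let the computed control be the output feedback law $$\hat f_i=-\rho_i\sum_{j\in\mathcal N_i(0)}\nabla_i\psi(\|x_{ij}\|)-\kappa_i\dot{\hat x}_i+\mathfrak g_i(q_i),\qquad \dot{\hat x}_i=-\zeta_i\hat x_i+x_i,$$ with filter initialization $\hat x_i(0)=x_i(0)/\zeta_i$, $i=1,\dots,N$. Suppose that the positive constants $Q,\rho_i,\zeta_i,\kappa_i$ ($i=1,\dots,N$) satisfy (a) for all $i=1,\dots,N$ and all $k=1,\dots,n$, $$2|\mathcal N_i(0)|\,\rho_i\,\sigma\, r+\sqrt{2\rho_i\kappa_i\psi(r)}+\gamma_i^k\le \bar f_i^k;$$ (b) with $\hat\lambda_{i20}$ the maximum eigenvalue of $M_i(q_i(0))$, $$\frac12\sum_{i=1}^N\Big[\frac{\hat\lambda_{i20}}{\rho_i}\|\dot q_i(0)\|^2+\sum_{j\in\mathcal N_i(0)}\psi(\|x_{ij}(0)\|)\Big]<\psi(r).$$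 Then this control is a connectivity-preserving coordination strategy for the network, i.e.: 1) all initial communication links are maintained: $\|x_{ij}(t)\|<r$ for all $(i,j)\in\mathcal E(0)$ and all $t\ge 0$; 2) all end effectors are driven to the same task-space configuration: $x_i(t)-x_j(t)\to 0$ as $t\to\infty$ for all $i,j\in\{1,\dots,N\}$.
   Context: Systems. For agent $i$, $q_i,\dot q_i,\ddot q_i$ are joint position, velocity and acceleration; $M_i,C_i,J_i$ are the inertia matrix, the matrix of Coriolis and centrifugal effects, and the Jacobian; $g_i$ is the gravity torque; $f_i$ is the control wrench applied in task space; $\dot x_i=J_i(q_i)\dot q_i$ is the end-effector velocity in task space, of dimension $n$. A superscript $k$ denotes the $k$-th component of a vector. All joints are revolute, and the systems operate away from kinematic singularities, i.e. through configurations where $J_i(q_i)$ is full rank (nonsingular). There the dynamics are equivalent to the task-space dynamics $$\mathfrak M_i(q_i)\ddot x_i+\mathfrak C_i(q_i,\dot q_i)\dot x_i+\mathfrak g_i(q_i)=f_i,$$ with $\mathfrak M_i=J_i^{-\mathsf T}M_iJ_i^{-1}$, $\mathfrak C_i=J_i^{-\mathsf T}C_iJ_i^{-1}-J_i^{-\mathsf T}M_iJ_i^{-1}\dot J_iJ_i^{-1}$, $\mathfrak g_i=J_i^{-\mathsf T}g_i$. Standing properties: P.1: $M_i(q_i)$ is symmetric with $0\prec\lambda_{i1}I\preceq M_i(q_i)\preceq\lambda_{i2}I$ for constants $\lambda_{i1},\lambda_{i2}>0$. P.2: $\dot{\mathfrak M}_i-2\mathfrak C_i$ is skew-symmetric.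 P.3: $\mathfrak M_i(q_i)$ is symmetric with $0\prec\lambda^*_{i1}I\preceq\mathfrak M_i(q_i)\preceq\lambda^*_{i2}I$ for constants $\lambda^*_{i1},\lambda^*_{i2}>0$. P.4: there is $c_i>0$ such that $\|\mathfrak C_i(q_i,\dot q_i)y\|\le c_i\|\dot x_i\|\|y\|$ for all $q_i,\dot q_i,y$ with $J_i(q_i)$ nonsingular. P.5: the dynamics admit a linear parameterization $\mathfrak M_i(q_i)\ddot x_r+\mathfrak C_i(q_i,\dot q_i)\dot x_r+\mathfrak g_i(q_i)=\Phi_i(q_i,\dot q_i,\dot x_r,\ddot x_r)\theta_i$, where $\Phi_i$ is a matrix of known functions and $\theta_i$ is a constant vector of system parameters, $\underline\theta_i\le\theta_i\le\overline\theta_i$. Communication graph. $\mathcal G(t)=(\mathcal V,\mathcal E(t))$ with $\mathcal V=\{1,\dots,N\}$; $(j,i)\in\mathcal E(t)$ iff systems $i$ and $j$ exchange state information at time $t$; $\mathcal N_i(t)$ is the set of systems adjacent to $i$. Communications are bidirectional (undirected graph). Assumptions: A.1: there exist $\gamma_i$ with $|\mathfrak g_i^k(q_i)|\le\gamma_i^k<\bar f_i^k$ for all $k=1,\dots,n$ throughout the task space, where $\bar f_i$ is the maximum task-space actuation wrench of system $i$. A.2: no edges are created during coordination: $(j,i)\notin\mathcal E(0)\Rightarrow(j,i)\notin\mathcal E(t)$ for all $t\ge0$. A.3: the systems have communication radius $r>0$; adjacent systems are at distance less than $r$, so preserving an initial link $(i,j)$ means keeping $\|x_{ij}(t)\|<r$.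 A.4: at $t=0$ the graph is connected and $\|x_{ij}(0)\|\le r-\epsilon$ for all $(i,j)\in\mathcal E(0)$, for some $\epsilon>0$ (with $\epsilon<r$). Bounded actuation. $\hat f_i$ is the computed control and $f_i$ is the wrench actually applied, with $|f_i^k|\le\bar f_i^k$; $f_i=\hat f_i$ whenever $|\hat f_i^k|\le\bar f_i^k$ for all $k$. Potential function. $\psi$ is a smooth function (with tunable parameter $Q>0$) of the inter-system distance such that: (1) $\psi(\|x_{ij}\|)$ is positive definite for $\|x_{ij}\|\in[0,r]$; (2) $\psi$ is strictly increasing and bounded above on $[0,r]$; (3) $\frac{\partial\psi(\|x_{ij}\|)}{\partial(\|x_{ij}\|^2)}\in[0,\sigma)$ for $\|x_{ij}\|\in[0,r]$; (4) the Hessian $\nabla^2_{ij}\psi(\|x_{ij}\|)$ with respect to $x_{ij}$ is positive definite and bounded above by $\nu I$ for $\|x_{ij}\|\in[0,r]$; (5) given $\|x_{ij}(0)\|\in[0,r-\epsilon]$ and $N>0$ with $0<\epsilon<r$, $N\psi(\|x_{ij}(0)\|)<\psi(r)$ can be guaranteed by properly tuning the parameter. The constants $\sigma,\nu$ may depend on $Q$. A particular such function is $\psi(\|x_{ij}\|)=\frac{\|x_{ij}\|^2}{r^2-\|x_{ij}\|^2+Q}$. The gradient with respect to $x_i$ is $\nabla_i\psi(\|x_{ij}\|)=2\frac{\partial\psi(\|x_{ij}\|)}{\partial(\|x_{ij}\|^2)}(x_i-x_j)$. *)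

(* Defs.v *)
(* MathComp-Analysis world *)
From HB Require Import structures.
From mathcomp Require Import all_boot all_order all_algebra ring.
From mathcomp Require Import all_classical all_reals all_analysis.

Set Implicit Arguments.
Unset Strict Implicit.
Unset Printing Implicit Defensive.

Import Order.TTheory GRing.Theory Num.Theory.
Import numFieldNormedType.Exports.

Local Open Scope classical_set_scope.
Local Open Scope ring_scope.

(* The library norm on matrices is the sup norm, hence this definition; the   *)
(* two induce the same topology, so limits, continuity and derivatives of     *)
(* vector-valued functions are those of the library.                          *)
Definition enorm (R : realType) (n : nat) (v : 'cV[R]_n) : R :=
  Num.sqrt (\sum_k v k 0 ^+ 2).

Definition qform (R : realType) (n : nat) (A : 'M[R]_n) (v : 'cV[R]_n) : R :=
  (v^T *m A *m v) 0 0.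

Definition loewner_le (R : realType) (n : nat) (A B : 'M[R]_n) : Prop :=
  forall v : 'cV[R]_n, 0 <= qform (B - A) v.

Definition posdefmx (R : realType) (n : nat) (A : 'M[R]_n) : Prop :=
  forall v : 'cV[R]_n, v != 0 -> 0 < qform A v.

Definition max_eigenvalue (R : realType) (n : nat) (A : 'M[R]_n) (a : R) : Prop :=
  eigenvalue A a /\ forall b : R, eigenvalue A b -> b <= a.

Definition gradient (R : realType) (n : nat) (F : 'cV[R]_n -> R) (y : 'cV[R]_n) :
    'cV[R]_n :=
  \col_k 'D_(delta_mx k 0) F y.

Definition hessian (R : realType) (n : nat) (F : 'cV[R]_n -> R) (y : 'cV[R]_n) :
    'M[R]_n :=
  \matrix_(a, b) 'D_(delta_mx a 0) (fun z => 'D_(delta_mx b 0) F z) y.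

(* C^oo on an open neighbourhood of [a, b]. *)
Definition smooth_near_itv (R : realType) (F : R -> R) (a b : R) : Prop :=
  exists2 d : R, 0 < d &
    forall (m : nat) (u : R), a - d < u < b + d -> derivable F^`(m)%classic u 1.

(* A non-redundant Euler-Lagrange system: the joint space and the task space  *)
(* have the same dimension, so the Jacobian is square.                        *)
Record el_system (R : realType) (n : nat) := ELSystem {
  (* configurations through which the system operates; they are away from
     the kinematic singularities, see [jac_unit] below *)
  op_region : set 'cV[R]_n ;
  (* joint position |-> end-effector configuration *)
  fkin : 'cV[R]_n -> 'cV[R]_n ;
  jac : 'cV[R]_n -> 'M[R]_n ;
  inertia : 'cV[R]_n -> 'M[R]_n ;
  (* joint position, joint velocity |-> Coriolis and centrifugal matrix *)
  coriolis : 'cV[R]_n -> 'cV[R]_n -> 'M[R]_n ;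
  gravity : 'cV[R]_n -> 'cV[R]_n ;
  npar : nat ;
  (* arguments: q, dq, dx_r, ddx_r *)
  regressor : 'cV[R]_n -> 'cV[R]_n -> 'cV[R]_n -> 'cV[R]_n -> 'M[R]_(n, npar) ;
  theta : 'cV[R]_npar ;
  theta_lo : 'cV[R]_npar ;
  theta_hi : 'cV[R]_npar
}.

Section TaskSpace.
Context (R : realType) (n : nat) (s : el_system R n).
Implicit Types q v : 'cV[R]_n.

(* The time derivatives of J(q(t)) and of the task-space inertia along a      *)
(* motion with velocity v are their directional derivatives along v.          *)
Definition jac_dot q v : 'M[R]_n := 'D_v (jac s) q.

Definition task_inertia q : 'M[R]_n :=
  (invmx (jac s q))^T *m inertia s q *m invmx (jac s q).

Definition task_inertia_dot q v : 'M[R]_n := 'D_v task_inertia q.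

Definition task_coriolis q v : 'M[R]_n :=
  (invmx (jac s q))^T *m coriolis s q v *m invmx (jac s q)
  - (invmx (jac s q))^T *m inertia s q *m invmx (jac s q)
      *m jac_dot q v *m invmx (jac s q).

Definition task_gravity q : 'cV[R]_n := (invmx (jac s q))^T *m gravity s q.

Record standing_properties : Prop := StandingProperties {
  jac_unit : forall q, op_region s q -> jac s q \in unitmx ;
  jac_fkin : forall q, op_region s q -> is_diff q (fkin s) (mulmx (jac s q)) ;
  jac_diff : forall q, op_region s q -> differentiable (jac s) q ;
  inertia_diff : forall q, op_region s q -> differentiable (inertia s) q ;
  inertia_sym : forall q, (inertia s q)^T = inertia s q ;
  inertia_bounds : exists l1 l2 : R, [/\ 0 < l1, 0 < l2 &
    forall q, loewner_le l1%:M (inertia s q) /\ loewner_le (inertia s q) l2%:M] ;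
  task_skew : forall q v, op_region s q ->
    let A := task_inertia_dot q v - 2 *: task_coriolis q v in A^T = - A ;
  task_inertia_sym : forall q, op_region s q ->
    (task_inertia q)^T = task_inertia q ;
  task_inertia_bounds : exists l1 l2 : R, [/\ 0 < l1, 0 < l2 &
    forall q, op_region s q ->
      loewner_le l1%:M (task_inertia q) /\ loewner_le (task_inertia q) l2%:M] ;
  task_coriolis_bound : exists2 c : R, 0 < c &
    forall q v y, op_region s q ->
      enorm (task_coriolis q v *m y) <= c * enorm (jac s q *m v) * enorm y ;
  linear_param : forall q v dxr ddxr, op_region s q ->
    task_inertia q *m ddxr + task_coriolis q v *m dxr + task_gravity q
    = regressor s q v dxr ddxr *m theta s ;
  theta_bounds : forall k,
    theta_lo s k 0 <= theta s k 0 /\ theta s k 0 <= theta_hi s k 0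
}.

Definition gravity_bounded (gamma fbar : 'cV[R]_n) : Prop :=
  forall k, (forall q, op_region s q -> `|task_gravity q k 0| <= gamma k 0)
            /\ gamma k 0 < fbar k 0.

(* The joint-space dynamics on t >= 0.  Differentiability is two-sided at     *)
(* t > 0; at the initial time, only continuity from the right is required.    *)
Record el_motion (q dq ddq f : R -> 'cV[R]_n) : Prop := ELMotion {
  motion_region : forall t : R, 0 <= t -> op_region s (q t) ;
  motion_q_cont : {within `[0, +oo[, continuous q} ;
  motion_dq_cont : {within `[0, +oo[, continuous dq} ;
  motion_dq : forall t : R, 0 < t -> is_derive t 1 q (dq t) ;
  motion_ddq : forall t : R, 0 < t -> is_derive t 1 dq (ddq t) ;
  motion_eq : forall t : R, 0 < t ->
    inertia s (q t) *m ddq t + coriolis s (q t) (dq t) *m dq t + gravity s (q t)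
    = (jac s (q t))^T *m f t
}.

End TaskSpace.

(* [f] is the wrench applied when [fhat] is computed; nothing is assumed on   *)
(* how the actuators saturate.                                                *)
Definition bounded_actuation (R : realType) (n : nat) (fbar : 'cV[R]_n)
    (fhat f : R -> 'cV[R]_n) : Prop :=
  forall t : R, 0 <= t ->
    (forall k, `|f t k 0| <= fbar k 0) /\
    ((forall k, `|fhat t k 0| <= fbar k 0) -> f t = fhat t).

(* [E t i j] holds when i and j exchange state information at time t. *)
Definition neighbours (N : nat) (R : realType) (E : R -> rel 'I_N) (t : R)
    (i : 'I_N) : {set 'I_N} := [set j | E t i j]%SET.

Record communication (R : realType) (N n : nat) (E : R -> rel 'I_N) (r eps : R)
    (x : 'I_N -> R -> 'cV[R]_n) : Prop := Communication {
  comm_undirected : forall t : R, 0 <= t -> symmetric (E t) /\ irreflexive (E t) ;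
  comm_no_creation : forall (t : R) i j, 0 <= t -> ~~ E 0 i j -> ~~ E t i j ;
  comm_radius_gt0 : 0 < r ;
  comm_radius : forall (t : R) i j, 0 <= t -> E t i j -> enorm (x i t - x j t) < r ;
  comm_connected : forall i j, connect (E 0) i j ;
  comm_eps : 0 < eps < r ;
  comm_margin : forall i j, E 0 i j -> enorm (x i 0 - x j 0) <= r - eps
}.

(* A potential is presented as a function [Psi Q] of the squared distance,    *)
(* so that its partial derivative with respect to the squared distance is     *)
(* [(Psi Q)^`()], two-sided at 0 as well.  No generality is lost: a radial    *)
(* function is smooth iff it is a smooth function of the squared distance.    *)
(* Nothing is assumed far beyond the distance r, where a potential such as    *)
(* s^2 / (r^2 - s^2 + Q) has a pole.                                          *)
Definition pot (R : realType) (Psi : R -> R -> R) (Q s : R) : R := Psi Q (s ^+ 2).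

Definition pot_vec (R : realType) (n : nat) (Psi : R -> R -> R) (Q : R)
    (y : 'cV[R]_n) : R := pot Psi Q (enorm y).

Record potential (R : realType) (n : nat) (r : R) (Psi : R -> R -> R)
    (sigma nu : R -> R) : Prop := Potential {
  pot_smooth : forall Q : R, 0 < Q -> smooth_near_itv (Psi Q) 0 (r ^+ 2) ;
  pot_0 : forall Q : R, 0 < Q -> pot Psi Q 0 = 0 ;
  pot_gt0 : forall Q s : R, 0 < Q -> 0 < s <= r -> 0 < pot Psi Q s ;
  pot_incr : forall Q s s' : R, 0 < Q -> 0 <= s -> s < s' -> s' <= r ->
    pot Psi Q s < pot Psi Q s' ;
  pot_bounded : forall Q : R, 0 < Q ->
    exists B : R, forall s : R, 0 <= s <= r -> pot Psi Q s <= B ;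
  pot_derive : forall Q s : R, 0 < Q -> 0 <= s <= r ->
    0 <= ((Psi Q)^`())%classic (s ^+ 2) < sigma Q ;
  pot_hessian : forall (Q : R) (y : 'cV[R]_n), 0 < Q -> enorm y <= r ->
    posdefmx (hessian (pot_vec Psi Q) y) /\
    loewner_le (hessian (pot_vec Psi Q) y) (nu Q)%:M ;
  pot_tuning : forall (eps : R) (m : nat), 0 < eps < r -> (0 < m)%N ->
    exists2 Q : R, 0 < Q &
      forall s : R, 0 <= s <= r - eps -> m%:R * pot Psi Q s < pot Psi Q r
}.

(* Gradient, with respect to the first configuration, of psi(|xi - xj|). *)
Definition grad_pot (R : realType) (n : nat) (Psi : R -> R -> R) (Q : R)
    (xi xj : 'cV[R]_n) : 'cV[R]_n :=
  gradient (fun y => pot_vec Psi Q (y - xj)) xi.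

Lemma grad_potE (R : realType) (n : nat) (Psi : R -> R -> R) (Q : R)
    (xi xj : 'cV[R]_n) :
  derivable (Psi Q) (enorm (xi - xj) ^+ 2) 1 ->
  grad_pot Psi Q xi xj
  = (2 * ((Psi Q)^`())%classic (enorm (xi - xj) ^+ 2)) *: (xi - xj).
Proof.
have enorm2 (v : 'cV[R]_n) : enorm v ^+ 2 = \sum_k v k 0 ^+ 2.
  by rewrite /enorm sqr_sqrtr// sumr_ge0// => k _; rewrite sqr_ge0.
rewrite /grad_pot /gradient => dP.
apply/colP => k; rewrite !mxE.
pose y := xi - xj.
pose p : R -> R := fun h => enorm y ^+ 2 + 2 * y k 0 * h + h ^+ 2.
have E h : pot_vec Psi Q (h *: delta_mx k 0 + xi - xj) = Psi Q (p h).
  rewrite /pot_vec /pot; congr (Psi Q _).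
  rewrite -addrA -/y /p !enorm2 (bigD1 k)//= [in RHS](bigD1 k)//=.
  have -> : \sum_(i < n | i != k) (h *: delta_mx k 0 + y) i 0 ^+ 2
          = \sum_(i < n | i != k) y i 0 ^+ 2.
    apply: eq_bigr => i /negPf ik.
    by rewrite !mxE ik mulr0 add0r.
  by rewrite !mxE !eqxx /=; ring.
have dp : is_derive (0:R) (1:R) p (2 * y k 0).
  have -> : p = (cst (enorm y ^+ 2) + (2 * y k 0) *: (@id R) + (@id R) ^+ 2).
    by apply/funext => h.
  have d0 := @is_derive_id R R 0 1.
  have d1 := is_deriveD (is_deriveD (is_derive_cst (enorm y ^+ 2) (0:R) (1:R)) (is_deriveZ (2 * y k 0) d0)) (is_deriveX 2 d0).
  apply: (is_derive_eq d1).
  by rewrite /GRing.scale /=; ring.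
have p0 : p 0 = enorm y ^+ 2 by rewrite /p mulr0 expr0n/= !addr0.
have dPp : is_derive (p 0) (1:R) (Psi Q) ('D_1 (Psi Q) (p 0)).
  by apply/derivableP; rewrite p0.
transitivity ('D_1 (Psi Q \o p) (0:R)).
  rewrite /derive.
  have -> : (fun h : R => h^-1 *: ((pot_vec Psi Q (h *: delta_mx k 0 + xi - xj) - pot_vec Psi Q (xi - xj)))) = (fun h : R => h^-1 *: ((Psi Q \o p) (h *: (1:R) + 0) - (Psi Q \o p) 0)).
    apply/funext => h /=.
    rewrite addr0 [h *: 1]mulr1 E.
    by have := E 0; rewrite scale0r add0r => ->.
  by [].
have -> := @derive_val _ _ _ _ _ _ _ (is_derive1_comp dPp dp).
rewrite derive1E p0 -/y /GRing.scale /= /y !mxE; ring.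
Qed.

Definition filter_dot (R : realType) (n : nat) (zeta : R) (xhat x : R -> 'cV[R]_n)
    (t : R) : 'cV[R]_n := - zeta *: xhat t + x t.

Record filter_motion (R : realType) (n : nat) (zeta : R)
    (xhat x : R -> 'cV[R]_n) : Prop := FilterMotion {
  filter_cont : {within `[0, +oo[, continuous xhat} ;
  filter_eq : forall t : R, 0 < t -> is_derive t 1 xhat (filter_dot zeta xhat x t) ;
  filter_init : xhat 0 = zeta^-1 *: x 0
}.

Definition output_feedback (R : realType) (N n : nat) (sys : 'I_N -> el_system R n)
    (E : R -> rel 'I_N) (Psi : R -> R -> R) (Q : R) (rho kappa zeta : 'I_N -> R)
    (q xhat x : 'I_N -> R -> 'cV[R]_n) (i : 'I_N) (t : R) : 'cV[R]_n :=
  - (rho i *: \sum_(j in neighbours E 0 i) grad_pot Psi Q (x i t) (x j t))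
  - kappa i *: filter_dot (zeta i) (xhat i) (x i) t
  + task_gravity (sys i) (q i t).

(* Main.v *)
Require Import Defs.
From HB Require Import structures.
From mathcomp Require Import all_boot all_order all_algebra ring lra.
From mathcomp Require Import all_classical all_reals all_analysis.

(** The total energy of the network, suitably weighted, decreases and is too
    small at the start to break a link.

    In task space the skew-symmetry of [A' - 2 C], where [A] is the task-space
    inertia and [C] the Coriolis matrix, says that the kinetic energy of a
    system changes at the power of the wrench in excess of gravity
    ([passive_el_motion]). Let [w i] be the rate of the filter of system [i],
    which obeys [w' = - zeta w + v]. The function
    [V = sum_i (K_i / rho_i + kappa_i |w_i|^2 / (2 rho_i))
         + sum_(links) psi (|x_ij|)],
    with [K_i] the kinetic energies, has derivative
    [- sum_i kappa_i zeta_i |w_i|^2 / rho_i] whenever the computed control is the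
    wrench applied: the damping injected through the filter replaces a velocity
    measurement.

    Links. The initial condition gives [V 0 < psi r]; the bound of the
    initial kinetic energy by the greatest eigenvalue of the inertia is
    [qform_le_max_eigenvalue]. As long as all links are within range and
    [kappa_i |w_i|^2 <= 2 rho_i psi r], the gain condition excludes saturation, so
    that [V] decreases; but then [V < psi r], which makes all these inequalities
    strict. They therefore hold forever ([operating_domain_invariant]).

    Consensus. Barbalat's lemma ([Barbalat]) is used three times, on signals whose
    derivatives are Lipschitz up to a vanishing term. As [V] converges, its
    derivative vanishes and [w] tends to 0; then so does [w'], and the
    velocity [w' + zeta w]; then so does the derivative of the momentum, which is the sum of
    the gradients up to vanishing terms. Hence the gradient sums tend to 0, and
    with them [sum_(links) psi' |x_ij|^2], where [psi'] is the derivative with respect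
    to the squared distance ([sqdist_vanishing]). Convexity of the potential
    along a line makes [s psi' (s^2)] increasing, hence bounded away from 0 for
    [s] bounded away from 0 ([attraction_lower_bound]); so the length of every
    link tends to 0, and the graph is connected. *)

Set Implicit Arguments.
Unset Strict Implicit.
Unset Printing Implicit Defensive.

Import Order.TTheory GRing.Theory Num.Theory.
Import numFieldNormedType.Exports.

Local Open Scope classical_set_scope.
Local Open Scope ring_scope.

(** * Inner products, quadratic forms and the spectral bound *)

Section InnerProduct.
Context {R : realType} {n : nat}.
Implicit Types (u v w : 'cV[R]_n) (A B : 'M[R]_n).

Definition dotv u v : R := (u^T *m v) 0 0.

Lemma dotvE u v : dotv u v = \sum_k u k 0 * v k 0.
Proof. by rewrite /dotv mxE; apply: eq_bigr => k _; rewrite mxE. Qed.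

Lemma dotvC u v : dotv u v = dotv v u.
Proof. by rewrite !dotvE; apply: eq_bigr => k _; rewrite mulrC. Qed.

Lemma dotvDr u v w : dotv u (v + w) = dotv u v + dotv u w.
Proof. by rewrite /dotv mulmxDr mxE. Qed.

Lemma dotvDl u v w : dotv (u + v) w = dotv u w + dotv v w.
Proof. by rewrite dotvC dotvDr !(dotvC w). Qed.

Lemma dotvZr a u v : dotv u (a *: v) = a * dotv u v.
Proof. by rewrite /dotv -scalemxAr mxE. Qed.

Lemma dotvZl a u v : dotv (a *: u) v = a * dotv u v.
Proof. by rewrite dotvC dotvZr dotvC. Qed.

Lemma dotvNr u v : dotv u (- v) = - dotv u v.
Proof. by rewrite -scaleN1r dotvZr mulN1r. Qed.

Lemma dotvBr u v w : dotv u (v - w) = dotv u v - dotv u w.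
Proof. by rewrite dotvDr dotvNr. Qed.

Lemma dotvBl u v w : dotv (u - v) w = dotv u w - dotv v w.
Proof. by rewrite dotvC dotvBr !(dotvC w). Qed.

Lemma dotv0 u : dotv u 0 = 0.
Proof. by rewrite -(scale0r 0) dotvZr mul0r. Qed.

Lemma dotv_sumr (I : finType) (P : pred I) u (F : I -> 'cV[R]_n) :
  dotv u (\sum_(i | P i) F i) = \sum_(i | P i) dotv u (F i).
Proof. by rewrite /dotv mulmx_sumr summxE. Qed.

Lemma dotv_trmx A u v : dotv u (A *m v) = dotv (A^T *m u) v.
Proof. by rewrite /dotv trmx_mul trmxK mulmxA. Qed.

Lemma dotv_delta k v : dotv (delta_mx k 0) v = v k 0.
Proof.
rewrite dotvE (bigD1 k)//= big1 ?addr0 => [|i /negPf ik].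
  by rewrite mxE !eqxx mul1r.
by rewrite mxE ik mul0r.
Qed.

Lemma qformE A v : qform A v = dotv v (A *m v).
Proof. by rewrite /qform /dotv mulmxA. Qed.

Lemma enorm_ge0 v : 0 <= enorm v.
Proof. exact: sqrtr_ge0. Qed.

Lemma sqr_enorm v : enorm v ^+ 2 = dotv v v.
Proof.
rewrite /enorm sqr_sqrtr; last by rewrite sumr_ge0// => k _; rewrite sqr_ge0.
by rewrite dotvE; apply: eq_bigr => k _; rewrite expr2.
Qed.

Lemma dotvv_ge0 v : 0 <= dotv v v.
Proof. by rewrite -sqr_enorm sqr_ge0. Qed.

Lemma dotvv_eq0 v : (dotv v v == 0) = (v == 0).
Proof.
apply/idP/eqP => [|->]; last by rewrite dotv0.
rewrite dotvE psumr_eq0 => [/allP v0|k _]; last by rewrite -expr2 sqr_ge0.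
apply/colP => k; rewrite mxE; apply/eqP.
by have := v0 k (mem_index_enum k); rewrite /= -expr2 sqrf_eq0.
Qed.

Lemma ler_abs_enorm v k : `|v k 0| <= enorm v.
Proof.
rewrite -(@ler_pXn2r _ 2) ?nnegrE ?normr_ge0 ?enorm_ge0// sqr_enorm.
rewrite real_normK ?num_real// dotvE (bigD1 k)//= expr2 lerDl.
by rewrite sumr_ge0// => i _; rewrite -expr2 sqr_ge0.
Qed.

Lemma enorm_le_sqr v (a : R) : 0 <= a -> (enorm v <= a) = (dotv v v <= a ^+ 2).
Proof. by move=> a0; rewrite -sqr_enorm ler_pXn2r// nnegrE ?enorm_ge0. Qed.

Lemma enorm_lt_sqr v (a : R) : 0 <= a -> (enorm v < a) = (dotv v v < a ^+ 2).
Proof. by move=> a0; rewrite -sqr_enorm ltr_pXn2r// nnegrE ?enorm_ge0. Qed.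

Lemma enorm_delta k : enorm (delta_mx k 0 : 'cV[R]_n) = 1.
Proof.
apply/eqP; rewrite -(@eqrXn2 _ 2) ?enorm_ge0// sqr_enorm dotv_delta.
by rewrite mxE !eqxx expr1n.
Qed.

(** The discriminant of the nonnegative trinomial [s |-> qform A (u + s v)]. *)
Lemma psd_Cauchy_Schwarz A u v : A^T = A -> (forall w, 0 <= qform A w) ->
  dotv u (A *m v) ^+ 2 <= qform A u * qform A v.
Proof.
move=> As A0.
have E s : qform A (u + s *: v)
         = qform A u + 2 * s * dotv u (A *m v) + s ^+ 2 * qform A v.
  rewrite !qformE mulmxDr -scalemxAr !(dotvDl, dotvDr, dotvZl, dotvZr).
  rewrite (dotv_trmx A v u) As (dotvC (A *m v) u); ring.
have [v0|v0] := eqVneq (qform A v) 0.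
  rewrite v0 mulr0; have [->|b0] := eqVneq (dotv u (A *m v)) 0.
    by rewrite expr0n.
  (* The trinomial is affine in [s], and takes the value -1 at this [s]. *)
  have := A0 (u + (- (qform A u + 1) / (2 * dotv u (A *m v))) *: v).
  rewrite E v0 mulr0 addr0.
  have -> : 2 * (- (qform A u + 1) / (2 * dotv u (A *m v))) * dotv u (A *m v)
            = - (qform A u + 1) by field.
  by lra.
have vp : 0 < qform A v by rewrite lt_def v0 A0.
(* The minimum of the trinomial. *)
have := A0 (u + (- dotv u (A *m v) / qform A v) *: v); rewrite E.
rewrite -(pmulr_lge0 _ vp).
set a := qform A u; set b := dotv u _; set c := qform A v in v0 vp *.
suff -> : (a + 2 * (- b / c) * b + (- b / c) ^+ 2 * c) * c = a * c - b ^+ 2.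
  by rewrite subr_ge0.
by field.
Qed.

Lemma qform1 v : qform 1%:M v = dotv v v.
Proof. by rewrite qformE mul1mx. Qed.

Lemma Cauchy_Schwarz u v : `|dotv u v| <= enorm u * enorm v.
Proof.
rewrite -(@ler_pXn2r _ 2) ?nnegrE ?normr_ge0 ?mulr_ge0 ?enorm_ge0//.
rewrite real_normK ?num_real// exprMn !sqr_enorm -!qform1.
have := @psd_Cauchy_Schwarz 1%:M u v (trmx1 _ _); rewrite mul1mx; apply => w.
by rewrite qform1 dotvv_ge0.
Qed.

Lemma loewner_le_scalarl a A v : loewner_le a%:M A -> a * dotv v v <= qform A v.
Proof.
move=> /(_ v); rewrite !qformE mulmxBl mul_scalar_mx dotvBr dotvZr.
by rewrite subr_ge0.
Qed.

Lemma loewner_le_scalarr a A v : loewner_le A a%:M -> qform A v <= a * dotv v v.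
Proof.
move=> /(_ v); rewrite !qformE mulmxBl mul_scalar_mx dotvBr dotvZr.
by rewrite subr_ge0.
Qed.

Lemma psd_mulmx_le A v (l : R) : 0 < l -> A^T = A -> (forall w, 0 <= qform A w) ->
  loewner_le A l%:M -> enorm (A *m v) <= l * enorm v.
Proof.
move=> l0 As A0 Al.
rewrite enorm_le_sqr ?mulr_ge0 ?enorm_ge0 ?(ltW l0)// exprMn sqr_enorm.
set u := A *m v.
have [u0|u0] := eqVneq (dotv u u) 0.
  by rewrite u0 mulr_ge0 ?sqr_ge0 ?dotvv_ge0.
have up : 0 < dotv u u by rewrite lt_def u0 dotvv_ge0.
rewrite -(ler_pM2l up) -expr2.
apply: (le_trans (psd_Cauchy_Schwarz u v As A0)).
rewrite (_ : _ * (_ * _) = (l * dotv u u) * (l * dotv v v)); last by ring.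
by apply: ler_pM => //; exact: loewner_le_scalarr.
Qed.

End InnerProduct.

Section Rayleigh.
Context {R : realType} {n : nat}.
Implicit Types (v : 'cV[R]_n) (A : 'M[R]_n).

Lemma cvg_big_sum (T I : Type) (F : set_system T) {FF : Filter F}
    (V : normedModType R) (s : seq I) (P : pred I) (h : I -> T -> V) (l : I -> V) :
  (forall i, P i -> h i x @[x --> F] --> l i) ->
  \sum_(i <- s | P i) h i x @[x --> F] --> \sum_(i <- s | P i) l i.
Proof. by move=> hl; apply: cvg_big => //; exact: add_continuous. Qed.

Lemma continuous_qform A : continuous (fun u : 'rV[R]_n => qform A u^T).
Proof.
move=> u.
rewrite (_ : (fun u => _) =
  fun u : 'rV[R]_n => \sum_i \sum_j u 0 i * (A i j * u 0 j)).
  apply: (@cvg_big_sum _ _ (nbhs u)) => i _.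
  apply: (@cvg_big_sum _ _ (nbhs u)) => j _.
  apply: cvgM; first exact: coord_continuous.
  by apply: cvgM; [exact: cvg_cst|exact: coord_continuous].
apply/funext => w; rewrite qformE dotvE; apply: eq_bigr => i _.
by rewrite !mxE big_distrr; apply: eq_bigr => j _; rewrite !mxE.
Qed.

(** The quadratic form attains its maximum [a] on the unit sphere, at [c] say.
    Then [a I - A] is positive semidefinite and its form vanishes at [c], so
    [c] lies in its kernel: [a] is an eigenvalue of [A], at most the greatest
    one. *)
Lemma qform_le_max_eigenvalue A (l : R) v : A^T = A -> max_eigenvalue A l ->
  qform A v <= l * enorm v ^+ 2.
Proof.
move=> As [_ maxl]; rewrite sqr_enorm.
have [->|v0] := eqVneq v 0.
  by rewrite qformE dotvC !dotv0 mulr0.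
have unit_scale (w : 'cV[R]_n) : w != 0 ->
    dotv ((enorm w)^-1 *: w) ((enorm w)^-1 *: w) = 1.
  move=> w0; rewrite dotvZl dotvZr -sqr_enorm.
  have : enorm w ^+ 2 != 0 by rewrite sqr_enorm dotvv_eq0.
  by rewrite sqrf_eq0 => ?; field.
pose S : set 'rV[R]_n := [set u | qform 1%:M u^T = 1].
have S0 : S !=set0.
  exists ((enorm v)^-1 *: v)^T => /=; rewrite /S /= trmxK qform1.
  exact: unit_scale.
have cS : compact S.
  apply: bounded_closed_compact.
    exists 1; split; first by rewrite num_real.
    move=> M M1 u Su; rewrite /Num.Def.normr/= mx_normrE.
    apply: bigmax_le => [|[i j] _] /=; first by rewrite ltW// (lt_trans ltr01).
    rewrite (le_trans _ (ltW M1))// ord1.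
    have /= := ler_abs_enorm u^T j; rewrite mxE => /le_trans; apply.
    by rewrite enorm_le_sqr// expr1n -qform1 Su.
  rewrite /S (_ : [set u | _] = (fun u : 'rV[R]_n => qform 1%:M u^T) @^-1` [set 1])//.
  by apply: preimage_closed => [u _|]; [exact: continuous_qform|exact: closed_eq].
have [|c Sc cmax] := EVT_max_rV S0 cS (f := fun u => qform A u^T).
  by apply: continuous_subspaceT => u; exact: continuous_qform.
pose a := qform A c^T.
have {}Sc : dotv c^T c^T = 1 by move: Sc; rewrite inE /S /= qform1.
have aP w : qform A w <= a * dotv w w.
  have [->|w0] := eqVneq w 0; first by rewrite qformE dotvC !dotv0 mulr0.
  have := cmax ((enorm w)^-1 *: w)^T; rewrite inE /S /= trmxK qform1.
  move=> /(_ (unit_scale w w0)); rewrite -/a.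
  have w1 : enorm w != 0 by rewrite -sqrf_eq0 sqr_enorm dotvv_eq0.
  have wp : 0 < enorm w ^+ 2 by rewrite lt_def sqrf_eq0 w1 sqr_ge0.
  rewrite -sqr_enorm qformE -scalemxAr dotvZl dotvZr -qformE.
  rewrite -(ler_pM2r wp) => H; apply: le_trans H.
  by rewrite le_eqVlt; apply/orP; left; apply/eqP; field.
have aE : eigenvalue A a.
  pose B := a%:M - A.
  have B0 w : 0 <= qform B w.
    by rewrite qformE mulmxBl mul_scalar_mx dotvBr dotvZr -qformE subr_ge0 aP.
  have Bs : B^T = B by rewrite /B linearB /= tr_scalar_mx As.
  have Bc : B *m c^T = 0.
    apply/eqP; rewrite -dotvv_eq0 -sqrf_eq0 eq_le sqr_ge0 andbT.
    rewrite (le_trans (psd_Cauchy_Schwarz _ _ Bs B0))//.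
    rewrite [X in _ * X]qformE mulmxBl mul_scalar_mx dotvBr dotvZr Sc mulr1 /a.
    by rewrite -qformE subrr mulr0.
  apply/eigenvalueP; exists c.
    apply: trmx_inj; rewrite trmx_mul As linearZ /=.
    by move/eqP: Bc; rewrite mulmxBl mul_scalar_mx subr_eq0 => /eqP.
  by apply/eqP => c0; move: Sc; rewrite c0 trmx0 dotv0 => /eqP; rewrite eq_sym oner_eq0.
apply: (le_trans (aP v)); rewrite ler_wpM2r ?dotvv_ge0//.
exact: maxl.
Qed.

End Rayleigh.

(** * Derivatives of matrix-valued functions *)

Section MatrixCalculus.
Context {R : realType}.

Lemma is_derive_big_sum (V W : normedModType R) (I : Type) (s : seq I)
    (P : pred I) (F : I -> V -> W) (dF : I -> W) (x v : V) :
  (forall i, P i -> is_derive x v (F i) (dF i)) ->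
  is_derive x v (fun y => \sum_(i <- s | P i) F i y) (\sum_(i <- s | P i) dF i).
Proof.
move=> dFi; elim: s => [|i s IHs].
  rewrite big_nil (_ : (fun y => _) = cst 0); first exact: is_derive_cst.
  by apply/funext => y; rewrite big_nil.
rewrite big_cons; case: ifPn => [Pi|nPi].
  rewrite (_ : (fun y => _) = F i + (fun y => \sum_(i <- s | P i) F i y)).
    by apply: is_deriveD; exact: dFi.
  by apply/funext => y; rewrite big_cons Pi.
rewrite (_ : (fun y => _) = (fun y => \sum_(i <- s | P i) F i y))//.
by apply/funext => y; rewrite big_cons (negPf nPi).
Qed.

Lemma is_derive_mxP (V : normedModType R) m n (F : V -> 'M[R]_(m, n)) dF x v :
  is_derive x v F dF <->
  forall i j, is_derive x v (fun y => F y i j) (dF i j).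
Proof.
split=> [[Fx <-] i j|dFij].
  have /derivable_mxP Fij := Fx.
  by rewrite derive_mx// mxE; apply/derivableP; exact: Fij.
have Fx : derivable F x v by apply/derivable_mxP => i j; case: (dFij i j).
apply: (DeriveDef Fx); rewrite derive_mx//; apply/matrixP => i j; rewrite mxE.
by case: (dFij i j).
Qed.

Lemma is_derive_mulmx (V : normedModType R) m n p (F : V -> 'M[R]_(m, n))
    (G : V -> 'M[R]_(n, p)) dF dG x v :
  is_derive x v F dF -> is_derive x v G dG ->
  is_derive x v (fun y => F y *m G y) (dF *m G x + F x *m dG).
Proof.
move=> /is_derive_mxP dFij /is_derive_mxP dGij; apply/is_derive_mxP => i j.
rewrite !mxE -big_split /=.
rewrite (_ : (fun y => _) = fun y => \sum_k F y i k * G y k j); last first.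
  by apply/funext => y; rewrite mxE.
apply: is_derive_big_sum => k _.
have dFG := is_deriveM (dFij i k) (dGij k j).
apply: (is_derive_eq dFG); rewrite addrC /GRing.scale /=; congr (_ + _); exact: mulrC.
Qed.

Lemma differentiable_mx (V : normedModType R) m n (F : V -> 'M[R]_(m, n)) x :
  (forall i j, differentiable (fun y => F y i j) x) -> differentiable F x.
Proof.
move=> dF.
rewrite (_ : F = \sum_i \sum_j (fun y => F y i j *: delta_mx i j)).
  by apply: differentiable_sum => i; apply: differentiable_sum => j; exact: differentiableZl.
apply/funext => y; rewrite fct_sumE {1}[F y]matrix_sum_delta.
by apply: eq_bigr => i _; rewrite fct_sumE.
Qed.

Lemma differentiable_entry (V : normedModType R) m n (F : V -> 'M[R]_(m, n)) x i j :
  differentiable F x -> differentiable (fun y => F y i j) x.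
Proof.
move=> dF; rewrite (_ : (fun y => _) = (fun A : 'M[R]_(m, n) => A i j) \o F)//.
exact/(differentiable_comp dF)/differentiable_coord.
Qed.

Lemma differentiable_big_sum (V W : normedModType R) (I : Type) (s : seq I)
    (F : I -> V -> W) (x : V) :
  (forall i, differentiable (F i) x) ->
  differentiable (fun y => \sum_(i <- s) F i y) x.
Proof.
move=> dF; elim: s => [|i s IHs].
  rewrite (_ : (fun y => _) = cst 0); first exact: differentiable_cst.
  by apply/funext => y; rewrite big_nil.
rewrite (_ : (fun y => _) = F i + (fun y => \sum_(i <- s) F i y)).
  exact: differentiableD.
by apply/funext => y; rewrite big_cons.
Qed.

Lemma differentiable_big_prod (V : normedModType R) (I : Type) (s : seq I)
    (F : I -> V -> R) (x : V) :
  (forall i, differentiable (F i) x) ->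
  differentiable (fun y => \prod_(i <- s) F i y) x.
Proof.
move=> dF; elim: s => [|i s IHs].
  rewrite (_ : (fun y => _) = cst 1); first exact: differentiable_cst.
  by apply/funext => y; rewrite big_nil.
rewrite (_ : (fun y => _) = F i * (fun y => \prod_(i <- s) F i y)).
  exact: differentiableM.
by apply/funext => y; rewrite big_cons.
Qed.

Lemma differentiable_mulmx (V : normedModType R) m n p (F : V -> 'M[R]_(m, n))
    (G : V -> 'M[R]_(n, p)) x :
  differentiable F x -> differentiable G x ->
  differentiable (fun y => F y *m G y) x.
Proof.
move=> dF dG; apply: differentiable_mx => i j.
rewrite (_ : (fun y => _) = fun y => \sum_k F y i k * G y k j); last first.
  by apply/funext => y; rewrite mxE.
by apply: differentiable_big_sum => k; apply: differentiableM; exact: differentiable_entry.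
Qed.

Lemma differentiable_det (V : normedModType R) n (F : V -> 'M[R]_n) x :
  differentiable F x -> differentiable (fun y => \det (F y)) x.
Proof.
move=> dF; apply: differentiable_big_sum => s; apply: differentiableM.
  exact: differentiable_cst.
by apply: differentiable_big_prod => i; exact: differentiable_entry.
Qed.

Lemma differentiable_adj (V : normedModType R) n (F : V -> 'M[R]_n) x :
  differentiable F x -> differentiable (fun y => \adj (F y)) x.
Proof.
move=> dF; apply: differentiable_mx => i j.
rewrite (_ : (fun y => _) = fun y => (-1) ^+ (j + i) * \det (row' j (col' i (F y)))).
  apply: differentiableM; first exact: differentiable_cst.
  apply: differentiable_det; apply: differentiable_mx => k l.
  rewrite (_ : (fun y => _) = fun y => F y (lift j k) (lift i l)).
    exact: differentiable_entry.
  by apply/funext => y; rewrite !mxE.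
by apply/funext => y; rewrite mxE.
Qed.

Lemma differentiable_trmx (V : normedModType R) m k (F : V -> 'M[R]_(m, k)) y :
  differentiable F y -> differentiable (fun z => (F z)^T) y.
Proof.
move=> dF; apply: differentiable_mx => i j.
rewrite (_ : (fun z => _) = fun z => F z j i); first exact: differentiable_entry.
by apply/funext => z; rewrite mxE.
Qed.

Lemma is_derive_dotv n (F G : R -> 'cV[R]_n) dF dG (t : R) :
  is_derive t 1 F dF -> is_derive t 1 G dG ->
  is_derive t 1 (fun t => dotv (F t) (G t)) (dotv dF (G t) + dotv (F t) dG).
Proof.
move=> /is_derive_mxP dFk /is_derive_mxP dGk.
rewrite (_ : (fun t => _) = fun t => \sum_k F t k 0 * G t k 0); last first.
  by apply/funext => z; rewrite dotvE.
rewrite !dotvE -big_split /=; apply: is_derive_big_sum => k _.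
apply: (is_derive_eq (is_deriveM (dFk k 0) (dGk k 0))).
by rewrite addrC /GRing.scale /=; congr (_ + _); exact: mulrC.
Qed.

Lemma cvg_dotv n (T : Type) (F : set_system T) {FF : Filter F}
    (f g : T -> 'cV[R]_n) l m :
  f t @[t --> F] --> l -> g t @[t --> F] --> m ->
  dotv (f t) (g t) @[t --> F] --> dotv l m.
Proof.
move=> fl gm; rewrite dotvE (_ : (fun t => _) = fun t => \sum_k f t k 0 * g t k 0).
  apply: cvg_big_sum => k _; apply: cvgM.
    exact: (cvg_comp _ _ fl (@coord_continuous _ _ _ k 0 _)).
  exact: (cvg_comp _ _ gm (@coord_continuous _ _ _ k 0 _)).
by apply/funext => t; rewrite dotvE.
Qed.

(** A composite changes at a rate that depends on [g] only through its velocity.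
    This identifies rates of change along a motion with the directional
    derivatives by which [jac_dot] and [task_inertia_dot] are defined. *)
Lemma is_derive_along_curve (U W : normedModType R) (g : R -> U) dg
    (F : U -> W) (t : R) :
  is_derive t 1 g dg -> differentiable F (g t) ->
  is_derive t 1 (F \o g) ('D_dg F (g t)).
Proof.
move=> [g't <-] dF.
have dgt : differentiable g t by apply/derivable1_diffP.
have dFg := differentiable_comp dgt dF.
apply: DeriveDef; first exact: diff_derivable.
by rewrite deriveE// diff_comp//= -!deriveE.
Qed.

End MatrixCalculus.

(** * Monotonicity, barriers and Barbalat's lemma on a half-line *)

Section HalfLine.
Context {R : realType}.
Implicit Types (h dh : R -> R) (a b s t : R).

Lemma is_derive_continuous (V : normedModType R) (h : R -> V) (v : V) t :
  is_derive t 1 h v -> {for t, continuous h}.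
Proof. by move=> [/derivable1_diffP /differentiable_continuous]. Qed.

Lemma MVT_right_continuous h dh a b : a < b -> h x @[x --> a^'+] --> h a ->
  (forall t, a < t <= b -> is_derive t 1 h (dh t)) ->
  exists2 c, a < c < b & h b - h a = dh c * (b - a).
Proof.
move=> ab ha hd.
have [||c cab ->] := @MVT R h dh a b ab; last by exists c.
- by move=> t; rewrite in_itv/= => /andP[at_ /ltW tb]; apply: hd; rewrite at_.
- apply/continuous_within_itvP => //; split => //.
    move=> t; rewrite in_itv/= => /andP[at_ /ltW tb].
    by apply: is_derive_continuous; apply: hd; rewrite at_.
  apply: cvg_at_left_filter.
  by apply: is_derive_continuous; apply: hd; rewrite ab lexx.
Qed.

Lemma lipschitz_derive h dh (L : R) :
  (forall t, 0 < t -> is_derive t 1 h (dh t)) ->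
  (forall t, 0 < t -> `|dh t| <= L) ->
  forall s t, 0 < s <= t -> `|h t - h s| <= L * (t - s).
Proof.
move=> hd dhL s t /andP[s0]; rewrite le_eqVlt => /orP[/eqP<-|st].
  by rewrite !subrr normr0 mulr0.
have [||c /andP[sc _] ->] := @MVT_right_continuous h dh s t st.
- by apply: cvg_at_right_filter; apply: is_derive_continuous; exact: hd.
- by move=> u /andP[su _]; apply: hd; exact: lt_trans su.
rewrite normrM (@ger0_norm _ (t - s)) ?subr_ge0 ?(ltW st)//.
by rewrite ler_wpM2r ?subr_ge0 ?(ltW st)//; apply: dhL; exact: lt_trans sc.
Qed.

Definition continuous_on_halfline (h : R -> R) : Prop :=
  h x @[x --> 0^'+] --> h 0 /\ forall t, 0 < t -> {for t, continuous h}.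

Lemma continuous_on_halfline_right h t : continuous_on_halfline h -> 0 <= t ->
  h x @[x --> t^'+] --> h t.
Proof.
move=> [h0 hc]; rewrite le_eqVlt => /orP[/eqP <-//|t0].
exact/cvg_at_right_filter/hc.
Qed.

(** Real induction: the first time at which some barrier is reached would be
    an instant at which no barrier has been passed, yet where the step
    hypothesis gives strict inequalities, which persist a little later. *)
Lemma barrier (I : finType) (h : I -> R -> R) (c : I -> R) :
  (forall i, continuous_on_halfline (h i)) ->
  (forall i, h i 0 < c i) ->
  (forall t, 0 < t -> (forall s, 0 <= s < t -> forall i, h i s < c i) ->
    (forall i, h i t <= c i) -> forall i, h i t < c i) ->
  forall t, 0 <= t -> forall i, h i t < c i.
Proof.
move=> hc h0 step t t0; apply: contrapT => hit.
pose S : set R := [set s | 0 <= s /\ ~ forall i, h i s < c i].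
have hS : has_inf S.
  by split; [exists t|exists 0 => s []].
pose T := inf S.
have T0 : 0 <= T by apply: lb_le_inf => [|s []]; case: hS.
have before s : 0 <= s < T -> forall i, h i s < c i.
  move=> /andP[s0 sT]; apply: contrapT => hs.
  by move: sT; rewrite ltNge inf_lbound//; case: hS.
have atT i : h i T < c i.
  move: T0 before; rewrite le_eqVlt => /orP[/eqP<- _|Tp before]; first exact: h0.
  apply: step => // {}i; rewrite leNgt; apply/negP => hT.
  have [_ /(_ _ Tp) /cvgrPdist_lt] := hc i.
  move=> /(_ (h i T - c i)); rewrite subr_gt0 => /(_ hT)[/= d d0 hd].
  pose s := Num.max 0 (T - d / 2).
  have sT : s < T by rewrite gt_max Tp/= ltrBlDr ltrDl divr_gt0.
  have s0 : 0 <= s by rewrite le_max lexx.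
  have /hd : `|T - s| < d.
    rewrite ger0_norm ?subr_ge0 ?(ltW sT)// ltrBlDr -ltrBlDl.
    by rewrite lt_max ltrD2l ltrN2 ltr_pdivrMr// mulr2n mulrDr mulr1 ltrDl d0 orbT.
  have := before s; rewrite s0 sT => /(_ isT i) hs.
  by move=> /(le_lt_trans (ler_norm _)); rewrite ltrD2l ltrN2 ltNge (ltW hs).
have : \forall s \near T^'+, forall i, h i s < c i.
  apply: filter_forall => i.
  apply: (cvgr_lt _ (continuous_on_halfline_right (hc i) T0)).
  exact: atT.
move=> [/= d d0 hd].
have : T + d <= T.
  apply: lb_le_inf => [|s Ss]; first by case: hS.
  rewrite leNgt; apply/negP => sd; case: (Ss) => s0; apply.
  have Ts : T <= s by apply: inf_lbound => //; case: hS.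
  move: Ts; rewrite le_eqVlt => /orP[/eqP<-//|Ts].
  apply: hd => //=; rewrite ltr0_norm ?subr_lt0// opprB ltrBlDl.
  by rewrite addrC addrC.
by rewrite gerDl leNgt d0.
Qed.

Lemma nonincreasing_converges h (b : R) :
  (forall s t, 0 <= s <= t -> h t <= h s) -> (forall t, 0 <= t -> b <= h t) ->
  exists l : R, h x @[x --> +oo] --> l.
Proof.
move=> hni hb; pose g t := - h (Num.max 0 t).
have gnd : nondecreasing_fun g.
  move=> s t st; rewrite lerN2; apply: hni; rewrite le_max lexx/=.
  by rewrite ge_max !le_max lexx st orbT.
have ubg : has_ubound (range g).
  by exists (- b) => _ [t _ <-]; rewrite lerN2; apply: hb; rewrite le_max lexx.
exists (- sup (range g)).
apply: cvg_trans (cvgN (nondecreasing_cvgr gnd ubg)).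
apply: near_eq_cvg; near=> t; rewrite /g /= opprK (_ : Num.max 0 t = t)//.
by apply: max_r; near: t; apply: nbhs_pinfty_ge => /=; exact: num_real.
Unshelve. all: by end_near. Qed.

(** Barbalat's lemma, for a derivative known up to a vanishing error [b]: by
    the mean value theorem [a + b] equals the slope of [w] somewhere in
    [[t, t + d]]. That slope vanishes at infinity for each fixed [d], and [a]
    differs there from [a t] by [L d] at most. *)
Lemma Barbalat (w a b : R -> R) (l L : R) :
  (forall t, 0 < t -> is_derive t 1 w (a t + b t)) ->
  w x @[x --> +oo] --> l ->
  (forall s t, 0 < s <= t -> `|a t - a s| <= L * (t - s)) ->
  b x @[x --> +oo] --> 0 -> a x @[x --> +oo] --> 0.
Proof.
move=> wd wl aL b0; apply/cvgr0Pnorm_le => e e0.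
have L0 : 0 <= L.
  have := aL 1 2; rewrite ltr01 ler1n => /(_ isT).
  by rewrite (_ : 2 - 1 = 1 :> R) ?mulr1; [exact: le_trans|ring].
(* The slope, [b] and the variation of [a] will be at most [e / 4] each. *)
pose d := e / (4 * (L + 1)).
have d0 : 0 < d by rewrite divr_gt0// mulr_gt0// ltr_wpDl.
have Ld : L * d <= e / 4.
  rewrite /d mulrA ler_pdivrMr ?mulr_gt0 ?ltr_wpDl//.
  have -> : e / 4 * (4 * (L + 1)) = L * e + e by field.
  by rewrite lerDl ltW.
have /cvgrPdist_le wl' := wl.
have e8 : 0 < e * d / 8 by rewrite divr_gt0// mulr_gt0.
have [A1 [A1r wA]] := wl' _ e8.
move/cvgr0Pnorm_le : b0 => /(_ (e / 4)); rewrite divr_gt0// => /(_ isT)[A2 [A2r bA]].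
near=> t.
have t0 : 0 < t by near: t; apply: nbhs_pinfty_gt; rewrite num_real.
have tA1 : A1 < t by near: t; exact: nbhs_pinfty_gt.
have tA2 : A2 < t by near: t; exact: nbhs_pinfty_gt.
have ttd : t < t + d by rewrite ltrDl.
have [||c /andP[tc ctd] E] := @MVT_right_continuous w (a \+ b) t (t + d) ttd.
- by apply: cvg_at_right_filter; apply: is_derive_continuous; exact: wd.
- by move=> u /andP[tu _]; apply: wd; exact: lt_trans tu.
have /= slope : `|(a \+ b) c| <= e / 4.
  rewrite -(ler_pM2r d0) -{1}(gtr0_norm d0) -normrM.
  move: E; rewrite (_ : t + d - t = d); last by ring.
  move=> <-; rewrite (_ : _ - _ = (l - w t) - (l - w (t + d))); last by ring.
  rewrite (le_trans (ler_normB _ _))//.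
  rewrite (_ : e / 4 * d = e * d / 8 + e * d / 8); last by field.
  by apply: lerD; apply: wA => //=; exact: lt_trans ttd.
have bc : `|b c| <= e / 4 by apply: bA; exact: lt_trans tc.
have ac : `|a c - a t| <= e / 4.
  apply: (le_trans (aL t c _)); first by rewrite t0 ltW.
  apply: le_trans Ld; rewrite ler_wpM2l// lerBlDl; exact: ltW.
have -> : a t = (a c + b c) - b c - (a c - a t) by ring.
rewrite (le_trans (ler_normB _ _))// (le_trans (lerD (ler_normB _ _) (lexx _)))//.
by lra.
Unshelve. all: by end_near. Qed.

End HalfLine.

(** * A single manipulator as a passive system *)

Section Passivity.
Context {R : realType} {n : nat}.

(** What the stability proof retains of a manipulator: [v] is the task-space
    velocity, [p] the momentum (task-space inertia times [v]), so that
    [dotv v p] is twice the kinetic energy, and [u] is the wrench in excess of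
    gravity. The energy grows at the power of [u] alone. The momentum changes
    at the rate [u] up to the Coriolis remainder [e], quadratic in [v].
    The constants are hidden under quantifiers, for only their existence
    matters. *)
Record passive_motion (x v dv p e u : R -> 'cV[R]_n) : Prop := PassiveMotion {
  passive_x0 : x t @[t --> 0^'+] --> x 0 ;
  passive_x : forall t : R, 0 < t -> is_derive t 1 x (v t) ;
  passive_v : forall t : R, 0 < t -> is_derive t 1 v (dv t) ;
  passive_p : forall t : R, 0 < t -> is_derive t 1 p (u t + e t) ;
  passive_energy0 : dotv (v t) (p t) @[t --> 0^'+] --> dotv (v 0) (p 0) ;
  passive_energy : forall t : R, 0 < t ->
    is_derive t 1 (fun t => dotv (v t) (p t)) (2 * dotv (v t) (u t)) ;
  passive_coercive : exists2 l : R, 0 < l &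
    forall t, 0 <= t -> l * enorm (v t) ^+ 2 <= dotv (v t) (p t) ;
  passive_momentum : exists l : R,
    forall t, 0 <= t -> enorm (p t) <= l * enorm (v t) ;
  passive_acceleration : exists a b : R,
    forall t, 0 < t -> enorm (dv t) <= a * enorm (u t) + b * enorm (v t) ^+ 2 ;
  passive_remainder : exists c : R, forall t, 0 < t ->
    forall k, `|e t k 0| <= c * enorm (v t) ^+ 2
}.

Context (s : el_system R n) (sp : standing_properties s)
  (q dq ddq f : R -> 'cV[R]_n) (em : el_motion s q dq ddq f).

Let v t := jac s (q t) *m dq t.
Let p t := task_inertia s (q t) *m v t.
Let u t := f t - task_gravity s (q t).
Let C t := task_coriolis s (q t) (dq t).
Let dv t := jac_dot s (q t) (dq t) *m dq t + jac s (q t) *m ddq t.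
Let e t := (C t)^T *m v t.

Lemma within_halfline_right (g : R -> 'cV[R]_n) :
  {within `[0, +oo[, continuous g} -> g t @[t --> 0^'+] --> g 0.
Proof. by move=> /continuous_within_itvcyP[]. Qed.

Lemma position_right_continuous t : 0 <= t -> q s @[s --> t^'+] --> q t.
Proof.
rewrite le_eqVlt => /orP[/eqP<-|t0].
  exact/within_halfline_right/(motion_q_cont em).
exact/cvg_at_right_filter/(is_derive_continuous (motion_dq em t0)).
Qed.

(** The inverse Jacobian is [\det^-1 *: \adj] near a nonsingular configuration,
    and this expression is differentiable there because its entries are
    rational functions of those of the Jacobian. *)
Lemma is_derive_task_inertia (t : R) : 0 < t ->
  is_derive t 1 (fun t => task_inertia s (q t)) (task_inertia_dot s (q t) (dq t)).
Proof.
move=> t0; have qr := motion_region em (ltW t0).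
pose Ji y := (\det (jac s y))^-1 *: \adj (jac s y).
pose F y := (Ji y)^T *m inertia s y *m Ji y.
have dJ := jac_diff sp qr.
have ddet := differentiable_det dJ.
have det0 : \det (jac s (q t)) != 0.
  by have := jac_unit sp qr; rewrite unitmxE unitfE.
have dJi : differentiable Ji (q t).
  apply: differentiable_mx => i j.
  rewrite (_ : (fun y => _) =
    (fun y => (\det (jac s y))^-1) * (fun y => \adj (jac s y) i j)).
    apply: differentiableM; first exact: (differentiableV ddet det0).
    exact/differentiable_entry/differentiable_adj.
  by apply/funext => y; rewrite mxE.
have dF : differentiable F (q t).
  apply: (differentiable_mulmx _ dJi); apply: differentiable_mulmx.
    exact: differentiable_trmx.
  exact: (inertia_diff sp qr).
have FE : \forall y \near q t, F y = task_inertia s y.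
  have neq0 := cvgr_neq0 _ (differentiable_continuous ddet) det0.
  near=> y; have dety : \det (jac s y) != 0 by near: y; exact: neq0.
  by rewrite /F /Ji /task_inertia /invmx unitmxE unitfE dety.
rewrite /task_inertia_dot -(near_eq_derive _ FE).
apply: (near_eq_is_derive _ (is_derive_along_curve (motion_dq em t0) dF)).
exact: (is_derive_continuous (motion_dq em t0) FE).
Unshelve. all: by end_near. Qed.

Lemma is_derive_task_velocity (t : R) : 0 < t -> is_derive t 1 v (dv t).
Proof.
move=> t0; have qr := motion_region em (ltW t0).
apply: is_derive_mulmx (motion_ddq em t0).
exact: (is_derive_along_curve (motion_dq em t0) (jac_diff sp qr)).
Qed.

(** The joint-space dynamics multiplied by the inverse transpose of the
    Jacobian. *)
Lemma task_dynamics (t : R) : 0 < t ->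
  task_inertia s (q t) *m dv t = u t - C t *m v t.
Proof.
move=> t0; have qr := motion_region em (ltW t0).
have Ju := jac_unit sp qr.
have Jv w : invmx (jac s (q t)) *m (jac s (q t) *m w) = w by rewrite mulKmx.
apply/eqP; rewrite eq_sym subr_eq eq_sym; apply/eqP.
rewrite /dv mulmxDr /v /C /task_coriolis mulmxBl /u /task_gravity /task_inertia.
rewrite -!mulmxA !Jv.
set X := _ *m (_ *m (_ *m (_ *m dq t))); rewrite addrC addrA subrK.
have := congr1 (mulmx (invmx (jac s (q t)))^T) (motion_eq em t0).
rewrite !mulmxDr [in RHS]mulmxA -trmx_mul mulmxV// trmx1 mul1mx => <-.
by rewrite addrK addrC.
Qed.

(** Symmetry passes to the derivative, and the skew-symmetry of
    [A' - 2 C] then determines it. *)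
Lemma task_inertia_dotE (t : R) : 0 < t ->
  task_inertia_dot s (q t) (dq t) = C t + (C t)^T.
Proof.
move=> t0; have qr := motion_region em (ltW t0).
have dA := is_derive_task_inertia t0.
have As : (task_inertia_dot s (q t) (dq t))^T = task_inertia_dot s (q t) (dq t).
  apply/matrixP => i j; rewrite mxE.
  have dji := (is_derive_mxP _ _ _ _).1 dA j i.
  have dij := (is_derive_mxP _ _ _ _).1 dA i j.
  rewrite -(@derive_val _ _ _ _ _ _ _ dji) -(@derive_val _ _ _ _ _ _ _ dij).
  apply: near_eq_derive; near=> z.
  have z0 : 0 < z by near: z; exact: (cvgr_gt t cvg_id).
  by rewrite -[in LHS](task_inertia_sym sp (motion_region em (ltW z0))) mxE.
have := task_skew sp (dq t) qr; rewrite /= linearB linearZ /= As -/(C t).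
move=> /matrixP E; apply/matrixP => i j.
by have := E i j; rewrite !mxE; lra.
Unshelve. all: by end_near. Qed.

Lemma is_derive_momentum (t : R) : 0 < t -> is_derive t 1 p (u t + e t).
Proof.
move=> t0.
have := is_derive_mulmx (is_derive_task_inertia t0) (is_derive_task_velocity t0).
move=> /is_derive_eq; apply.
by rewrite task_inertia_dotE// task_dynamics// mulmxDl addrC addrA subrK.
Qed.

Lemma is_derive_energy (t : R) : 0 < t ->
  is_derive t 1 (fun t => dotv (v t) (p t)) (2 * dotv (v t) (u t)).
Proof.
move=> t0; have qr := motion_region em (ltW t0).
apply: (is_derive_eq (is_derive_dotv (is_derive_task_velocity t0) (is_derive_momentum t0))).
rewrite {1}/p dotv_trmx (task_inertia_sym sp qr) task_dynamics//.
rewrite dotvBl dotvDr /e dotv_trmx trmxK (dotvC (u t)); ring.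
Qed.

(** In joint space the energy involves neither the Jacobian nor its inverse,
    hence its continuity at the initial time and its bound by the eigenvalues
    of the joint-space inertia. *)
Lemma energyE (t : R) : 0 <= t ->
  dotv (v t) (p t) = qform (inertia s (q t)) (dq t).
Proof.
move=> t0; have Ju := jac_unit sp (motion_region em t0).
rewrite /p /task_inertia -!mulmxA dotv_trmx trmxK qformE.
by rewrite /v !mulKmx.
Qed.

Lemma energy_right_continuous :
  dotv (v t) (p t) @[t --> 0^'+] --> dotv (v 0) (p 0).
Proof.
rewrite energyE// qformE dotvE.
have -> : \sum_k dq 0 k 0 * (inertia s (q 0) *m dq 0) k 0 =
          \sum_k \sum_l dq 0 k 0 * (inertia s (q 0) k l * dq 0 l 0).
  by apply: eq_bigr => k _; rewrite mxE big_distrr.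
have dqr k : dq t k 0 @[t --> 0^'+] --> dq 0 k 0.
  have dq0 := within_halfline_right (motion_dq_cont em).
  exact: (cvg_comp _ _ dq0 (@coord_continuous _ _ _ k 0 _)).
have Mr k l : inertia s (q t) k l @[t --> 0^'+] --> inertia s (q 0) k l.
  have dM := inertia_diff sp (motion_region em (lexx 0)).
  have cM := differentiable_continuous (differentiable_entry k l dM).
  exact: (cvg_comp _ _ (position_right_continuous (lexx 0)) cM).
apply: (@cvg_trans _ ((\sum_k \sum_l
    dq t k 0 * (inertia s (q t) k l * dq t l 0)) @[t --> 0^'+])).
  apply: near_eq_cvg; near=> t.
  have t0 : 0 <= t by [].
  rewrite energyE// qformE dotvE.
  by apply: eq_bigr => k _; rewrite mxE big_distrr.
apply: cvg_big_sum => k _; apply: cvg_big_sum => l _.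
by apply: cvgM => //; apply: cvgM.
Unshelve. all: by end_near. Qed.

(** The power of the Coriolis terms is cancelled by the change of inertia, and
    the uniform bounds on the task-space inertia compare energy, momentum and
    acceleration with the velocity and the wrench. *)
Lemma passive_el_motion :
  passive_motion (fun t => fkin s (q t)) v dv p e u.
Proof.
have [l1 [l2 [l1p l2p Al]]] := task_inertia_bounds sp.
have [c cp Cc] := task_coriolis_bound sp.
have Apsd t : 0 <= t -> forall w, 0 <= qform (task_inertia s (q t)) w.
  move=> t0 w; have [Al1 _] := Al _ (motion_region em t0).
  by apply: le_trans (loewner_le_scalarl w Al1); rewrite mulr_ge0 ?dotvv_ge0 ?ltW.
have Cv (t : R) w : 0 <= t -> enorm (C t *m w) <= c * enorm (v t) * enorm w.
  by move=> t0; apply: Cc; exact: (motion_region em).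
split.
- have dx := jac_fkin sp (motion_region em (lexx 0)).
  apply: continuous_cvg (position_right_continuous (lexx 0)).
  by apply: differentiable_continuous; case: dx.
- move=> t t0; have [dx xE] := jac_fkin sp (motion_region em (ltW t0)).
  apply: is_derive_eq (is_derive_along_curve (motion_dq em t0) dx) _.
  by rewrite deriveE// xE.
- exact: is_derive_task_velocity.
- exact: is_derive_momentum.
- exact: energy_right_continuous.
- exact: is_derive_energy.
- exists l1 => // t t0; have [Al1 _] := Al _ (motion_region em t0).
  by rewrite sqr_enorm -qformE; exact: loewner_le_scalarl.
- exists l2 => t t0; have [_ Al2] := Al _ (motion_region em t0).
  apply: psd_mulmx_le => //; last exact: Apsd.
  exact/(task_inertia_sym sp)/(motion_region em).
- exists l1^-1, (l1^-1 * c) => t t0.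
  have [dv0|dv0] := eqVneq (enorm (dv t)) 0.
    rewrite dv0 addr_ge0// mulr_ge0 ?enorm_ge0 ?invr_ge0 ?(ltW l1p)//.
      by rewrite mulr_ge0 ?invr_ge0 ?ltW.
    by rewrite sqr_ge0.
  have dvp : 0 < enorm (dv t) by rewrite lt_def dv0 enorm_ge0.
  rewrite -mulrA -mulrDr ler_pdivlMl// -(ler_pM2l dvp).
  have [Al1 _] := Al _ (motion_region em (ltW t0)).
  have := loewner_le_scalarl (dv t) Al1; rewrite -sqr_enorm qformE.
  rewrite task_dynamics// dotvBr => H.
  rewrite mulrCA -expr2 (le_trans H)// mulrDr lerD//.
    exact: le_trans (ler_norm _) (Cauchy_Schwarz _ _).
  rewrite (le_trans (ler_norm _))// normrN (le_trans (Cauchy_Schwarz _ _))//.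
  by rewrite ler_wpM2l ?enorm_ge0// expr2 mulrA; exact/Cv/ltW.
- exists c => t t0 k; rewrite -dotv_delta /e dotv_trmx trmxK.
  apply: (le_trans (Cauchy_Schwarz _ _)).
  rewrite expr2 mulrA ler_wpM2r ?enorm_ge0//.
  by apply: (le_trans (Cv _ _ (ltW t0))); rewrite enorm_delta mulr1.
Qed.

End Passivity.

(** * The potential as a function of the squared distance *)

Section Potential.
Context {R : realType} {n : nat} (r : R) (Psi : R -> R -> R) (sigma nu : R -> R).
Context (pP : potential n r Psi sigma nu) (Q : R) (Q0 : 0 < Q) (r0 : 0 < r).
Let phi := Psi Q.
Let dphi := (phi^`())%classic.
Let ddphi := (dphi^`())%classic.

Lemma smooth_potential : exists2 d : R, 0 < d & forall u : R, - d < u < r ^+ 2 + d ->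
  [/\ is_derive u 1 phi (dphi u), is_derive u 1 dphi (ddphi u)
    & {for u, continuous ddphi}].
Proof.
have [d d0 sm] := pot_smooth pP Q0.
exists d => // u ud; split.
- by rewrite /dphi derive1E; apply/derivableP; apply: (sm 0%N); rewrite sub0r.
- by rewrite /ddphi derive1E; apply/derivableP; apply: (sm 1%N); rewrite sub0r.
- apply: differentiable_continuous; apply/derivable1_diffP.
  by apply: (sm 2%N); rewrite sub0r.
Qed.

Lemma derive_along_line (V W : normedModType R) (F : V -> W) (v : V) (s : R) :
  'D_v F (s *: v) = 'D_1 (fun w : R => F (w *: v)) s.
Proof.
rewrite /derive.
have -> // : (fun h : R => h^-1 *: (F (h *: v + s *: v) - F (s *: v))) =
  (fun h => h^-1 *: (F ((h *: 1 + s) *: v) - F (s *: v))).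
by apply/funext => h; rewrite scalerDl [h *: 1]mulr1.
Qed.

Lemma is_derive_sqr (u : R) : is_derive u 1 (fun w : R => w ^+ 2) (2 * u).
Proof.
apply: (is_derive_eq (is_deriveX 2 (is_derive_id u 1))).
by rewrite /GRing.scale /= mulr1 expr1 mulr_natl.
Qed.

(** Along a coordinate axis the potential is [phi (s ^ 2)], so that a diagonal
    entry of the Hessian is the second derivative of this function. *)
Lemma pot_convex (k : 'I_n) (s : R) : 0 <= s <= r ->
  0 < dphi (s ^+ 2) + 2 * s ^+ 2 * ddphi (s ^+ 2).
Proof.
move=> /andP[s0 sr].
have [d d0 sm] := smooth_potential.
pose e : 'cV[R]_n := delta_mx k 0.
have e1 : dotv e e = 1 by rewrite -sqr_enorm enorm_delta expr1n.
have sqd u : u ^+ 2 < r ^+ 2 + d -> - d < u ^+ 2 < r ^+ 2 + d.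
  by move=> ->; rewrite andbT; apply: lt_le_trans (sqr_ge0 u); rewrite oppr_lt0.
have sd : s ^+ 2 < r ^+ 2 + d.
  by rewrite ltr_pwDr// ler_pXn2r ?nnegrE// (le_trans s0).
have F_line w : pot_vec Psi Q (w *: e) = phi (w ^+ 2).
  by rewrite /pot_vec /pot sqr_enorm dotvZl dotvZr e1 mulr1.
have F_line' w : w ^+ 2 < r ^+ 2 + d ->
    'D_e (pot_vec Psi Q) (w *: e) = dphi (w ^+ 2) * (2 * w).
  move=> /sqd/sm[dw _ _]; rewrite derive_along_line.
  rewrite (_ : (fun w => _) = phi \o (fun w : R => w ^+ 2)); last exact/funext.
  by have [_ ->] := @is_derive1_comp _ phi (fun w : R => w ^+ 2) w _ _ dw (is_derive_sqr w).
have H_kk : hessian (pot_vec Psi Q) (s *: e) k k =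
    2 * (dphi (s ^+ 2) + 2 * s ^+ 2 * ddphi (s ^+ 2)).
  rewrite mxE derive_along_line -/e.
  rewrite (_ : 'D_1 _ s = 'D_1 (fun w : R => dphi (w ^+ 2) * (2 * w)) s); last first.
    apply: near_eq_derive; near=> w; apply: F_line'.
    by near: w; apply: cvgr_lt (is_derive_continuous (is_derive_sqr s)) _ sd.
  have [_ dds _] := sm _ (sqd _ sd).
  have d1 := @is_derive1_comp _ dphi (fun w : R => w ^+ 2) s _ _ dds (is_derive_sqr s).
  have d2 : is_derive s 1 (fun w : R => 2 * w) 2.
    apply: (is_derive_eq (is_deriveZ 2 (is_derive_id s 1))).
    by rewrite /GRing.scale /= mulr1.
  have -> := @derive_val _ _ _ _ _ _ _ (is_deriveM d1 d2).
  by rewrite /GRing.scale /=; ring.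
have se : enorm (s *: e) <= r.
  rewrite enorm_le_sqr ?(le_trans s0)// dotvZl dotvZr e1 mulr1.
  by rewrite -expr2 ler_pXn2r ?nnegrE// (le_trans s0).
have [Hp _] := pot_hessian pP Q0 se.
have := Hp e; rewrite qformE dotv_delta -colE mxE H_kk pmulr_rgt0//; apply.
by rewrite -dotvv_eq0 e1 oner_neq0.
Unshelve. all: by end_near. Qed.

(** The derivative [2 s phi'(s ^ 2)] of [phi (s ^ 2)] vanishes at [0] and
    increases, by convexity, hence the attraction never vanishes at positive
    distance. *)
Lemma attraction_lower_bound (k : 'I_n) (eps : R) : 0 < eps ->
  exists2 del : R, 0 < del &
    forall u, eps <= u <= r ^+ 2 -> del <= dphi u * u.
Proof.
move=> eps0; have [d d0 sm] := smooth_potential.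
have [epsr|reps] := leP eps (r ^+ 2); last first.
  exists 1 => // u /andP[eu ur].
  by have := lt_le_trans reps (le_trans eu ur); rewrite ltxx.
pose mu s := s * dphi (s ^+ 2).
have dmu s : 0 <= s <= r ->
    is_derive s 1 mu (dphi (s ^+ 2) + 2 * s ^+ 2 * ddphi (s ^+ 2)).
  move=> /andP[s0 sr].
  have [_ dds _] : [/\ is_derive (s ^+ 2) 1 phi (dphi (s ^+ 2)),
      is_derive (s ^+ 2) 1 dphi (ddphi (s ^+ 2)) & {for s ^+ 2, continuous ddphi}].
    apply: sm; rewrite (lt_le_trans _ (sqr_ge0 s)) ?oppr_lt0//=.
    by rewrite ltr_pwDr// ler_pXn2r ?nnegrE// (le_trans s0).
  have dc := @is_derive1_comp _ dphi (fun w : R => w ^+ 2) s _ _ dds (is_derive_sqr s).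
  apply: (is_derive_eq (is_deriveM (is_derive_id s 1) dc)).
  by rewrite /GRing.scale /=; ring.
have mu_lt s s' : 0 <= s -> s < s' -> s' <= r -> mu s < mu s'.
  move=> s0 ss' s'r.
  have [||c /andP[sc cs'] E] := @MVT_right_continuous _ mu
    (fun s => dphi (s ^+ 2) + 2 * s ^+ 2 * ddphi (s ^+ 2)) s s' ss'.
  - apply: cvg_at_right_filter; apply: (is_derive_continuous (dmu s _)).
    by rewrite s0 (le_trans (ltW ss')).
  - move=> t /andP[st ts']; apply: dmu.
    by rewrite (le_trans s0 (ltW st)) (le_trans ts').
  rewrite -subr_gt0 E mulr_gt0 ?subr_gt0//; apply: (pot_convex k).
  by rewrite (le_trans s0 (ltW sc)) (le_trans (ltW cs')).
pose s0 := Num.sqrt eps.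
have s0p : 0 < s0 by rewrite sqrtr_gt0.
have s0r : s0 <= r by rewrite -(ger0_norm (ltW r0)) -sqrtr_sqr ler_wsqrtr.
have mup : 0 < mu s0 by have := mu_lt 0 s0 (lexx _) s0p s0r; rewrite /mu mul0r.
exists (s0 * mu s0); first exact: mulr_gt0.
move=> u /andP[eu ur]; have u0 : 0 <= u by rewrite (le_trans (ltW eps0)).
have -> : dphi u * u = Num.sqrt u * mu (Num.sqrt u).
  by rewrite /mu sqr_sqrtr// mulrA -expr2 sqr_sqrtr// mulrC.
have su : s0 <= Num.sqrt u by rewrite ler_wsqrtr.
apply: ler_pM => //; [exact: ltW|exact: ltW|].
move: su; rewrite le_eqVlt => /orP[/eqP<-//|su].
apply/ltW/mu_lt => //; first exact: ltW.
by rewrite -(ger0_norm (ltW r0)) -sqrtr_sqr ler_wsqrtr.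
Qed.

Lemma potential_ge0 (u : R) : 0 <= u <= r ^+ 2 -> 0 <= phi u.
Proof.
move=> /andP[u0 ur].
have E : phi u = pot Psi Q (Num.sqrt u) by rewrite /pot sqr_sqrtr.
have [u1|u1] := eqVneq u 0.
  by have := pot_0 pP Q0; rewrite u1 /pot expr0n /= -/phi => ->.
rewrite E ltW// (pot_gt0 pP)// sqrtr_gt0 lt_def u1 u0/=.
by rewrite -(ger0_norm (ltW r0)) -sqrtr_sqr ler_wsqrtr.
Qed.

Lemma curvature_bounded : exists B : R, forall u, 0 <= u <= r ^+ 2 -> `|ddphi u| <= B.
Proof.
have [d d0 sm] := smooth_potential.
have [|c _ cmax] := @EVT_max R (fun u => `|ddphi u|) 0 (r ^+ 2) (sqr_ge0 r).
  apply: continuous_in_subspaceT => u; rewrite inE /= in_itv /= => /andP[u0 ur].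
  have [|_ _ cu] := sm u; last exact: (cvg_norm cu).
  by rewrite (lt_le_trans _ u0) ?oppr_lt0//= ltr_pwDr.
by exists `|ddphi c| => u ur; apply: cmax; rewrite in_itv.
Qed.

End Potential.

(** * Bounded and vanishing signals *)

Section Signals.
Context {R : realType}.
Implicit Types a b : R -> R.

Definition bounded_signal a : Prop :=
  exists B : R, forall t : R, 0 < t -> `|a t| <= B.

Definition vanishing a : Prop := a t @[t --> +oo] --> 0.

Lemma bounded_signal_le a b : bounded_signal b ->
  (forall t, 0 < t -> `|a t| <= b t) -> bounded_signal a.
Proof.
move=> [B hB] ab; exists B => t t0.
exact: le_trans (ab t t0) (le_trans (ler_norm _) (hB t t0)).
Qed.

Lemma bounded_signal_cst (c : R) : bounded_signal (fun=> c).
Proof. by exists `|c|. Qed.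

Lemma bounded_signalD a b : bounded_signal a -> bounded_signal b ->
  bounded_signal (fun t => a t + b t).
Proof.
move=> [A hA] [B hB]; exists (A + B) => t t0.
by rewrite (le_trans (ler_normD _ _))// lerD ?hA ?hB.
Qed.

Lemma bounded_signalM a b : bounded_signal a -> bounded_signal b ->
  bounded_signal (fun t => a t * b t).
Proof.
move=> [A hA] [B hB]; exists (A * B) => t t0.
by rewrite normrM ler_pM ?hA ?hB.
Qed.

Lemma bounded_signalZ (c : R) a : bounded_signal a ->
  bounded_signal (fun t => c * a t).
Proof. exact/bounded_signalM/bounded_signal_cst. Qed.

Lemma bounded_signalB a b : bounded_signal a -> bounded_signal b ->
  bounded_signal (fun t => a t - b t).
Proof.
move=> ha [B hB]; apply: bounded_signalD => //.
by exists B => t t0; rewrite normrN hB.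
Qed.

Lemma bounded_signal_sum (I : Type) (s : seq I) (P : pred I) (a : I -> R -> R) :
  (forall i, P i -> bounded_signal (a i)) ->
  bounded_signal (fun t => \sum_(i <- s | P i) a i t).
Proof.
move=> ha; elim: s => [|i s IHs].
  by exists 0 => t _; rewrite big_nil normr0.
have [Pi|nPi] := boolP (P i).
  apply: (bounded_signal_le (b := fun t => `|a i t| + `|\sum_(i <- s | P i) a i t|)).
    apply: bounded_signalD.
      by have [B hB] := ha i Pi; exists B => t t0; rewrite normr_id hB.
    by have [B hB] := IHs; exists B => t t0; rewrite normr_id hB.
  by move=> t _; rewrite big_cons Pi ler_normD.
by have [B hB] := IHs; exists B => t t0; rewrite big_cons (negPf nPi) hB.
Qed.

Lemma bounded_dotv n (f g : R -> 'cV[R]_n) :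
  (forall k, bounded_signal (fun t => f t k 0)) ->
  (forall k, bounded_signal (fun t => g t k 0)) ->
  bounded_signal (fun t => dotv (f t) (g t)).
Proof.
move=> hf hg.
rewrite (_ : (fun t => _) = fun t => \sum_k f t k 0 * g t k 0); last first.
  by apply/funext => t; rewrite dotvE.
by apply: bounded_signal_sum => k _; exact: bounded_signalM.
Qed.

Lemma bounded_enorm n (f : R -> 'cV[R]_n) :
  (forall k, bounded_signal (fun t => f t k 0)) ->
  bounded_signal (fun t => enorm (f t)).
Proof.
move=> hf; apply: bounded_signal_le (bounded_signalD (bounded_signal_cst 1)
  (bounded_dotv hf hf)) _ => t _.
rewrite (ger0_norm (enorm_ge0 _)) -sqr_enorm.
set y := enorm (f t); have := sqr_ge0 (y - 1); rewrite -subr_ge0 => H.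
have : 0 <= y by exact: enorm_ge0.
by nra.
Qed.

Lemma bounded_entry n (f : R -> 'cV[R]_n) k :
  bounded_signal (fun t => enorm (f t)) -> bounded_signal (fun t => f t k 0).
Proof. by move=> hf; apply: bounded_signal_le hf _ => t _; exact: ler_abs_enorm. Qed.

Lemma bounded_enorm_sqr n (f : R -> 'cV[R]_n) :
  bounded_signal (fun t => dotv (f t) (f t)) -> bounded_signal (fun t => enorm (f t)).
Proof.
move=> [B hB]; exists (1 + B) => t t0.
rewrite (ger0_norm (enorm_ge0 _)); have := le_trans (ler_norm _) (hB t t0).
rewrite -sqr_enorm.
set y := enorm (f t); have := sqr_ge0 (y - 1); have : 0 <= y by exact: enorm_ge0.
by nra.
Qed.

Lemma vanishing_le a b : vanishing b -> (forall t, 0 < t -> `|a t| <= b t) ->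
  vanishing a.
Proof.
move=> b0 ab; apply/cvgr0Pnorm_le => e e0.
move/cvgr0Pnorm_le : b0 => /(_ e e0) b0; near=> t.
have t0 : 0 < t by near: t; apply: nbhs_pinfty_gt; exact: num_real.
have bt : `|b t| <= e by near: t; exact: b0.
exact: le_trans (ab t t0) (le_trans (ler_norm _) bt).
Unshelve. all: by end_near. Qed.

Lemma vanishingD a b : vanishing a -> vanishing b ->
  vanishing (fun t => a t + b t).
Proof. by move=> a0 b0; rewrite /vanishing -(addr0 0); exact: cvgD. Qed.

Lemma vanishing0 : vanishing (fun=> 0).
Proof. exact: cvg_cst. Qed.

Lemma bounded_vanishingM a b : bounded_signal a -> vanishing b ->
  vanishing (fun t => a t * b t).
Proof.
move=> [A hA] b0; apply: (vanishing_le (b := fun t => A * `|b t|)).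
  rewrite /vanishing -(mulr0 A); apply: cvgMl_tmp.
  by rewrite -(@normr0 _ R); exact: cvg_norm.
by move=> t t0; rewrite normrM ler_wpM2r ?hA.
Qed.

Lemma vanishingZ (c : R) a : vanishing a -> vanishing (fun t => c * a t).
Proof. exact/bounded_vanishingM/bounded_signal_cst. Qed.

Lemma vanishingZK (c : R) a : c != 0 -> vanishing (fun t => c * a t) -> vanishing a.
Proof.
move=> c0 /(vanishingZ c^-1); rewrite (_ : (fun t => _) = a)//.
by apply/funext => t; rewrite mulKf.
Qed.

Lemma vanishing_sum (I : Type) (s : seq I) (P : pred I) (a : I -> R -> R) :
  (forall i, P i -> vanishing (a i)) ->
  vanishing (fun t => \sum_(i <- s | P i) a i t).
Proof.
move=> ha; have := cvg_big_sum (F := +oo) (s := s) (l := fun=> 0) ha.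
by rewrite big1_eq => H; exact: H.
Qed.

Lemma vanishing_dotv n (f g : R -> 'cV[R]_n) :
  (forall k, bounded_signal (fun t => f t k 0)) ->
  (forall k, vanishing (fun t => g t k 0)) ->
  vanishing (fun t => dotv (f t) (g t)).
Proof.
move=> hf hg.
rewrite (_ : (fun t => _) = fun t => \sum_k f t k 0 * g t k 0); last first.
  by apply/funext => t; rewrite dotvE.
by apply: vanishing_sum => k _; exact: bounded_vanishingM.
Qed.

Lemma vanishing_enorm n (f : R -> 'cV[R]_n) :
  vanishing (fun t => dotv (f t) (f t)) -> vanishing (fun t => enorm (f t)).
Proof.
move=> f0; rewrite /vanishing -(@sqrtr0 R).
rewrite (_ : (fun t => _) = fun t => Num.sqrt (dotv (f t) (f t))).
  by apply: continuous_cvg => //; exact: sqrt_continuous.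
by apply/funext => t; rewrite -sqr_enorm sqrtr_sqr ger0_norm ?enorm_ge0.
Qed.

Lemma vanishing_entry n (f : R -> 'cV[R]_n) k :
  vanishing (fun t => enorm (f t)) -> vanishing (fun t => f t k 0).
Proof. by move=> hf; apply: vanishing_le hf _ => t _; exact: ler_abs_enorm. Qed.

End Signals.

(** * The closed loop *)

Section Network.
Context {R : realType} {N n : nat}.
Context (edge : rel 'I_N) (edge_sym : symmetric edge).
Context (r : R) (r0 : 0 < r) (phi dphi ddphi : R -> R) (sigma : R).
Context (phi_d : forall z : R, 0 <= z <= r ^+ 2 -> is_derive z 1 phi (dphi z)).
Context (dphi_d : forall z : R, 0 <= z <= r ^+ 2 -> is_derive z 1 dphi (ddphi z)).
Context (phi_ge0 : forall z : R, 0 <= z <= r ^+ 2 -> 0 <= phi z).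
Context (dphi_lt : forall z : R, 0 <= z <= r ^+ 2 -> 0 <= dphi z < sigma).
Context (x v dv p err u xhat : 'I_N -> R -> 'cV[R]_n) (rho zeta kappa : 'I_N -> R).
Context (rho_gt0 : forall i, 0 < rho i) (zeta_gt0 : forall i, 0 < zeta i)
  (kappa_gt0 : forall i, 0 < kappa i).
Context (pass : forall i,
  passive_motion (x i) (v i) (dv i) (p i) (err i) (u i)).
Context (filt : forall i, filter_motion (zeta i) (xhat i) (x i)).

Definition filter_rate i (t : R) : 'cV[R]_n := filter_dot (zeta i) (xhat i) (x i) t.
Local Notation w := filter_rate.

Definition sqdist i j (t : R) : R := dotv (x i t - x j t) (x i t - x j t).
Local Notation d := sqdist.

Definition coupling i (t : R) : 'cV[R]_n :=
  \sum_(j | edge i j) (2 * dphi (d i j t)) *: (x i t - x j t).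
Local Notation G := coupling.

Definition in_range (t : R) : Prop := forall i j, edge i j -> d i j t <= r ^+ 2.

(** An agent accounts for its kinetic energy, for its filter, and for half of
    each of its links. The weights make the cross terms between coupling,
    velocity and filter rate cancel in the derivative of the sum. *)
Definition storage i (t : R) : R :=
  (2 * rho i)^-1 * dotv (v i t) (p i t)
  + (2 * rho i)^-1 * (kappa i * dotv (w i t) (w i t))
  + 2^-1 * \sum_(j | edge i j) phi (d i j t).

Definition lyapunov (t : R) : R := \sum_i storage i t.
Local Notation V := lyapunov.

Definition lyapunov_rate (t : R) : R :=
  \sum_i ((rho i)^-1 * dotv (v i t) (u i t)
    + (rho i)^-1 * (kappa i * dotv (w i t) (v i t - zeta i *: w i t))
    + \sum_(j | edge i j) dphi (d i j t) * dotv (x i t - x j t) (v i t - v j t)).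

Definition dissipation (t : R) : R :=
  \sum_i (rho i)^-1 * (kappa i * (zeta i * dotv (w i t) (w i t))).

(** The gain condition keeps the computed control within the actuation bounds
    as long as links are within range and filters are slow enough; it is then
    the wrench that is applied. The threshold for the filter is the one at
    which its term in the Lyapunov function reaches [phi (r ^+ 2)]. *)
Context (unsaturated : forall i (t : R), 0 <= t -> in_range t ->
  kappa i * dotv (w i t) (w i t) <= 2 * rho i * phi (r ^+ 2) ->
  u i t = - (rho i *: G i t) - kappa i *: w i t).

Lemma sqdist_ge0 i j t : 0 <= d i j t. Proof. exact: dotvv_ge0. Qed.

Lemma sqdistC i j t : d i j t = d j i t.
Proof. by rewrite /d -opprB dotvNr dotvC dotvNr opprK. Qed.

Lemma in_rangeP i j t : in_range t -> edge i j -> 0 <= d i j t <= r ^+ 2.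
Proof. by move=> rt eij; rewrite sqdist_ge0 rt. Qed.

(** Each edge is met from its two ends, with opposite differences. *)
Lemma edge_sum (a : 'I_N -> 'I_N -> R) (y z : 'I_N -> 'cV[R]_n) :
  (forall i j, a i j = a j i) ->
  \sum_i \sum_(j | edge i j) a i j * dotv (y i - y j) (z i - z j)
  = \sum_i dotv (z i) (\sum_(j | edge i j) (2 * a i j) *: (y i - y j)).
Proof.
move=> aC.
pose S := \sum_i \sum_(j | edge i j) a i j * dotv (y i - y j) (z i).
have SN : \sum_i \sum_(j | edge i j) a i j * dotv (y i - y j) (z j) = - S.
  rewrite (exchange_big_dep xpredT)//= /S -sumrN; apply: eq_bigr => j _.
  rewrite -sumrN (eq_bigl (edge j)); last by move=> i; rewrite edge_sym.
  apply: eq_bigr => i _.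
  by rewrite -(opprB (y j)) dotvC dotvNr (dotvC (z j)) aC mulrN.
transitivity (S - - S).
  rewrite -SN /S -sumrB; apply: eq_bigr => i _; rewrite -sumrB.
  by apply: eq_bigr => j _; rewrite dotvBr mulrBr.
rewrite opprK -mulr2n /S -sumrMnl; apply: eq_bigr => i _.
rewrite dotv_sumr -sumrMnl; apply: eq_bigr => j _.
by rewrite dotvZr dotvC -mulrA mulr_natl.
Qed.

Lemma coupling_power (z : 'I_N -> 'cV[R]_n) t :
  \sum_i dotv (z i) (G i t) =
  \sum_i \sum_(j | edge i j) dphi (d i j t) * dotv (x i t - x j t) (z i - z j).
Proof.
rewrite (@edge_sum (fun i j => dphi (d i j t)) (fun i => x i t))// => i j.
by rewrite sqdistC.
Qed.

Lemma is_derive_diff i j (t : R) : 0 < t ->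
  is_derive t 1 (fun t => x i t - x j t) (v i t - v j t).
Proof. by move=> t0; apply: is_deriveB; exact: (passive_x (pass _)). Qed.

Lemma is_derive_sqdist i j (t : R) : 0 < t ->
  is_derive t 1 (d i j) (2 * dotv (x i t - x j t) (v i t - v j t)).
Proof.
move=> t0; have dx := is_derive_diff i j t0.
apply: (is_derive_eq (is_derive_dotv dx dx)).
by rewrite dotvC mulr_natl mulr2n.
Qed.

(** The filter rate is itself the velocity passed through the same filter. *)
Lemma is_derive_filter_rate i (t : R) : 0 < t ->
  is_derive t 1 (w i) (v i t - zeta i *: w i t).
Proof.
move=> t0.
have := is_deriveD (is_deriveZ (- zeta i) (filter_eq (filt i) t0)) (passive_x (pass i) t0).
by move=> /is_derive_eq; apply; rewrite scaleNr addrC.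
Qed.

Lemma is_derive_lyapunov (t : R) : 0 < t -> in_range t ->
  is_derive t 1 V (lyapunov_rate t).
Proof.
move=> t0 rt; apply: is_derive_big_sum => i _.
have rho0 : rho i != 0 by rewrite gt_eqF.
apply: is_deriveD; first apply: is_deriveD.
- apply: (is_derive_eq (is_deriveZ (2 * rho i)^-1 (passive_energy (pass i) t0))).
  by rewrite /GRing.scale /=; field.
- have dw := is_derive_filter_rate i t0.
  have := is_deriveZ (2 * rho i)^-1 (is_deriveZ (kappa i) (is_derive_dotv dw dw)).
  move=> /is_derive_eq; apply; rewrite /GRing.scale /=.
  by rewrite (dotvC (v i t - _)); field.
- have dphid j : edge i j -> is_derive t 1 (fun t => phi (d i j t))
      (dphi (d i j t) * (2 * dotv (x i t - x j t) (v i t - v j t))).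
    move=> eij.
    exact: (@is_derive1_comp _ phi (d i j) t _ _ (phi_d (in_rangeP rt eij))
      (is_derive_sqdist i j t0)).
  have := is_deriveZ 2^-1 (is_derive_big_sum (index_enum 'I_N) dphid).
  move=> /is_derive_eq; apply; rewrite /GRing.scale /= mulr_sumr.
  by apply: eq_bigr => j _; field.
Qed.

(** The applied control returns to the agents the power that the links take,
    and exchanges power with the filters, where all the losses occur. *)
Lemma lyapunov_rateE (t : R) : 0 <= t -> in_range t ->
  (forall i, kappa i * dotv (w i t) (w i t) <= 2 * rho i * phi (r ^+ 2)) ->
  lyapunov_rate t = - dissipation t.
Proof.
move=> t0 rt wt; rewrite /lyapunov_rate big_split /= -coupling_power -big_split /=.
rewrite /dissipation -sumrN; apply: eq_bigr => i _.
have rho0 : rho i != 0 by rewrite gt_eqF.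
rewrite unsaturated// !dotvBr !dotvNr !dotvZr (dotvC (w i t) (v i t)).
by field.
Qed.

Lemma dissipation_ge0 t : 0 <= dissipation t.
Proof.
apply: sumr_ge0 => i _.
by rewrite !mulr_ge0 ?invr_ge0 ?dotvv_ge0 ?ltW.
Qed.

Lemma energy_ge0 i t : 0 <= t -> 0 <= dotv (v i t) (p i t).
Proof.
move=> t0; have [l l0 /(_ _ t0)] := passive_coercive (pass i).
by apply: le_trans; rewrite mulr_ge0 ?sqr_ge0 ?ltW.
Qed.

Lemma storage_ge i t : 0 <= t -> in_range t ->
  [/\ (2 * rho i)^-1 * dotv (v i t) (p i t) <= storage i t,
      (2 * rho i)^-1 * (kappa i * dotv (w i t) (w i t)) <= storage i t &
      forall j, edge i j -> 2^-1 * phi (d i j t) <= storage i t].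
Proof.
move=> t0 rt; rewrite /storage.
have A : 0 <= (2 * rho i)^-1 * dotv (v i t) (p i t).
  by rewrite mulr_ge0 ?energy_ge0 ?invr_ge0 ?mulr_ge0 ?(ltW (rho_gt0 i)).
have B : 0 <= (2 * rho i)^-1 * (kappa i * dotv (w i t) (w i t)).
  rewrite !mulr_ge0 ?dotvv_ge0 ?invr_ge0 ?mulr_ge0 ?(ltW (rho_gt0 i))//.
  exact: ltW.
have C j : edge i j -> 0 <= phi (d i j t).
  by move=> eij; apply: phi_ge0; exact: in_rangeP.
have D : 0 <= \sum_(j | edge i j) phi (d i j t) by exact: sumr_ge0.
split; [lra|lra|move=> j eij].
have : phi (d i j t) <= \sum_(j | edge i j) phi (d i j t).
  by rewrite (bigD1 j)//= lerDl sumr_ge0// => k /andP[/C].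
by lra.
Qed.

Lemma storage_ge0 i t : 0 <= t -> in_range t -> 0 <= storage i t.
Proof.
move=> t0 rt; have [A _ _] := storage_ge i t0 rt.
apply: le_trans A.
by rewrite mulr_ge0 ?energy_ge0 ?invr_ge0 ?mulr_ge0 ?(ltW (rho_gt0 i)).
Qed.

Lemma storage_le_lyapunov i t : 0 <= t -> in_range t -> storage i t <= V t.
Proof.
move=> t0 rt; rewrite /lyapunov (bigD1 i)//= lerDl sumr_ge0// => j _.
exact: storage_ge0.
Qed.

(** An edge is counted at both ends, so that it contributes [phi], and not
    half of it. *)
Lemma phi_le_lyapunov i j t : 0 <= t -> in_range t -> edge i j -> i != j ->
  phi (d i j t) <= V t.
Proof.
move=> t0 rt eij ij; rewrite /lyapunov (bigD1 i)//= (bigD1 j) 1?eq_sym//= addrA.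
have [_ _ /(_ j eij) A] := storage_ge i t0 rt.
have [_ _ /(_ i)] := storage_ge j t0 rt; rewrite edge_sym sqdistC => /(_ eij) B.
have C : 0 <= \sum_(k < N | (k != i) && (k != j)) storage k t.
  by apply: sumr_ge0 => k _; exact: storage_ge0.
by lra.
Qed.

Lemma couplingE i t k : G i t k 0 =
  \sum_(j | edge i j) 2 * dphi (d i j t) * (x i t - x j t) k 0.
Proof. by rewrite /G summxE; apply: eq_bigr => j _; rewrite mxE. Qed.

Lemma coupling_le i t k : in_range t ->
  `|G i t k 0| <= 2 * #|edge i|%:R * sigma * r.
Proof.
move=> rt; rewrite couplingE (le_trans (ler_norm_sum _ _ _))//.
have -> : 2 * #|edge i|%:R * sigma * r = \sum_(j | edge i j) 2 * sigma * r.
  by rewrite sumr_const -mulr_natl; ring.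
apply: ler_sum => j eij; have /andP[a0 /ltW as_] := dphi_lt (in_rangeP rt eij).
rewrite !normrM (ger0_norm a0) gtr0_norm//.
apply: ler_pM; rewrite ?mulr_ge0 ?normr_ge0//; first exact: ler_wpM2l.
by rewrite (le_trans (ler_abs_enorm _ _))// enorm_le_sqr ?(ltW r0)//; exact: rt.
Qed.

Lemma lyapunov_nonincreasing s t : 0 <= s < t ->
  V y @[y --> s^'+] --> V s ->
  (forall y, s < y <= t -> in_range y) ->
  (forall y, s < y < t ->
    forall i, kappa i * dotv (w i y) (w i y) <= 2 * rho i * phi (r ^+ 2)) ->
  V t <= V s.
Proof.
move=> /andP[s0 st] Vs ry wy.
have [|c /andP[sc ct] E] := MVT_right_continuous st Vs (dh := lyapunov_rate).
  move=> y /andP[sy yt]; apply: is_derive_lyapunov; first exact: le_lt_trans sy.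
  by apply: ry; rewrite sy.
have c0 : 0 <= c by rewrite (le_trans s0)// ltW.
rewrite -subr_le0 E lyapunov_rateE//; last 2 first.
- by apply: ry; rewrite sc ltW.
- by apply: wy; rewrite sc.
by rewrite mulNr oppr_le0 mulr_ge0 ?dissipation_ge0 ?subr_ge0 ?(ltW st).
Qed.

Lemma sqdist_right_continuous i j : d i j t @[t --> 0^'+] --> d i j 0.
Proof.
have dx : x i t - x j t @[t --> 0^'+] --> x i 0 - x j 0.
  exact: cvgB (passive_x0 (pass i)) (passive_x0 (pass j)).
exact: (cvg_dotv dx dx).
Qed.

Lemma filter_energy_right_continuous i :
  dotv (w i t) (w i t) @[t --> 0^'+] --> dotv (w i 0) (w i 0).
Proof.
have wr : w i t @[t --> 0^'+] --> w i 0.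
  apply: cvgD; last exact: (passive_x0 (pass i)).
  apply: cvgZl_tmp.
  exact/within_halfline_right/(filter_cont (filt i)).
exact: (cvg_dotv wr wr).
Qed.

Lemma lyapunov_right_continuous : in_range 0 -> V t @[t --> 0^'+] --> V 0.
Proof.
move=> r00; apply: cvg_big_sum => i _; apply: cvgD; first apply: cvgD.
- by apply: cvgMl_tmp; exact: (passive_energy0 (pass i)).
- by apply: cvgMl_tmp; apply: cvgMl_tmp; exact: filter_energy_right_continuous.
- apply: cvgMl_tmp; apply: cvg_big_sum => j eij.
  have cphi := is_derive_continuous (phi_d (in_rangeP r00 eij)).
  exact: (cvg_comp _ _ (@sqdist_right_continuous i j) cphi).
Qed.

(** The filters start at equilibrium, so that they store no energy at first. *)
Lemma filter_rate0 i : w i 0 = 0.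
Proof.
rewrite /w /filter_dot (filter_init (filt i)) scalerA mulNr mulfV ?gt_eqF//.
by rewrite scaleN1r addNr.
Qed.

Context (range0 : forall i j, edge i j -> d i j 0 < r ^+ 2).
Context (V0 : V 0 < phi (r ^+ 2)).

Lemma in_range0 : in_range 0.
Proof. by move=> i j eij; exact: ltW (range0 eij). Qed.

(** As long as every link is within range and every filter is slow, the
    actuators are not saturated and the Lyapunov function decreases from a value
    below the energy [phi (r ^ 2)] that a broken link or a fast filter would
    require: neither can occur first. *)
Lemma operating_domain_invariant t : 0 <= t ->
  (forall i j, edge i j -> d i j t < r ^+ 2) /\
  (forall i, kappa i * dotv (w i t) (w i t) < 2 * rho i * phi (r ^+ 2)).
Proof.
pose h (a : 'I_N * 'I_N + 'I_N) t := match a with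
  | inl (i, j) => if edge i j then d i j t else 0
  | inr i => kappa i * dotv (w i t) (w i t) end.
pose c (a : 'I_N * 'I_N + 'I_N) := match a with
  | inl (i, j) => if edge i j then r ^+ 2 else 1
  | inr i => 2 * rho i * phi (r ^+ 2) end.
suff good : forall t, 0 <= t -> forall a, h a t < c a.
  move=> t0; split=> [i j eij|i]; last exact: good t0 (inr i).
  by have := good t t0 (inl (i, j)); rewrite /h /c eij.
have V_ge0 : 0 <= V 0.
  by apply: sumr_ge0 => i _; apply: storage_ge0 => //; exact: in_range0.
have inP s : (forall a, h a s <= c a) -> in_range s /\
    forall i, kappa i * dotv (w i s) (w i s) <= 2 * rho i * phi (r ^+ 2).
  move=> hs; split=> [i j eij|i]; last exact: hs (inr i).
  by have := hs (inl (i, j)); rewrite /h /c eij.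
have start a : h a 0 < c a.
  case: a => [[i j]|i] /=; first by case: ifPn => // /range0.
  rewrite filter_rate0 dotv0 mulr0 mulr_gt0 ?mulr_gt0//.
  exact: le_lt_trans V0.
have hcont a : continuous_on_halfline (h a).
  case: a => [[i j]|i]; rewrite /h.
    case: (edge i j); last by split=> [|s _]; [exact: cvg_cst|exact: cvg_cst].
    split=> [|s s0]; first exact: sqdist_right_continuous.
    exact: is_derive_continuous (is_derive_sqdist i j s0).
  split=> [|s s0]; first by apply: cvgMl_tmp; exact: filter_energy_right_continuous.
  have dw := is_derive_filter_rate i s0.
  by apply: cvgMl_tmp; exact: is_derive_continuous (is_derive_dotv dw dw).
apply: barrier => // s s0 before at_s.
have [rs _] := inP s at_s.
have Vs : V s < phi (r ^+ 2).
  apply: le_lt_trans V0; apply: lyapunov_nonincreasing.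
  - by rewrite lexx.
  - exact/lyapunov_right_continuous/in_range0.
  - move=> y /andP[y0]; rewrite le_eqVlt => /orP[/eqP->//|ys].
    have [] // := inP y => a; apply/ltW/before; by rewrite (ltW y0).
  - move=> y /andP[y0 ys].
    have [] // := inP y => a; apply/ltW/before; by rewrite (ltW y0).
case=> [[i j]|i] /=.
  case: ifPn => // eij; rewrite lt_neqAle rs// andbT.
  have [->|ij] := eqVneq i j.
    by rewrite /d subrr dotv0 lt_eqF// exprn_gt0.
  apply/eqP => dr; have := phi_le_lyapunov (ltW s0) rs eij ij.
  by rewrite dr leNgt Vs.
have [_ A _] := storage_ge i (ltW s0) rs.
have := le_lt_trans A (le_lt_trans (storage_le_lyapunov i (ltW s0) rs) Vs).
by rewrite ltr_pdivrMl ?mulr_gt0.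
Qed.

Lemma in_range_forever t : 0 <= t -> in_range t.
Proof. by move=> t0 i j eij; have [H _] := operating_domain_invariant t0; exact/ltW/H. Qed.

Lemma filter_energy_le i t : 0 <= t ->
  kappa i * dotv (w i t) (w i t) <= 2 * rho i * phi (r ^+ 2).
Proof. by move=> t0; have [_ H] := operating_domain_invariant t0; exact/ltW/H. Qed.

Lemma control_applied i t : 0 < t -> u i t = - (rho i *: G i t) - kappa i *: w i t.
Proof.
by move=> t0; apply: unsaturated; rewrite ?filter_energy_le ?ltW//; exact/in_range_forever/ltW.
Qed.

Lemma control_appliedE i t k : 0 < t ->
  u i t k 0 = - rho i * G i t k 0 - kappa i * w i t k 0.
Proof.
move=> t0; rewrite control_applied//; move: (G i t) (w i t) => g y.
by rewrite !mxE mulNr.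
Qed.

Lemma is_derive_lyapunov_dissipation (t : R) : 0 < t ->
  is_derive t 1 V (- dissipation t).
Proof.
move=> t0; have rt := in_range_forever (ltW t0).
apply: is_derive_eq (is_derive_lyapunov t0 rt) _.
by apply: lyapunov_rateE => // [|i]; [exact: ltW|exact/filter_energy_le/ltW].
Qed.

Lemma lyapunov_decreasing s t : 0 <= s <= t -> V t <= V s.
Proof.
move=> /andP[s0]; rewrite le_eqVlt => /orP[/eqP<-//|st].
apply: lyapunov_nonincreasing; first by rewrite s0.
- move: s0; rewrite le_eqVlt => /orP[/eqP<-|s0].
    exact/lyapunov_right_continuous/in_range0.
  apply: cvg_at_right_filter.
  exact/is_derive_continuous/is_derive_lyapunov_dissipation.
- by move=> y /andP[sy _]; apply/in_range_forever/(le_trans s0)/ltW.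
- by move=> y /andP[sy _] i; apply/filter_energy_le/(le_trans s0)/ltW.
Qed.

Lemma filter_rate_bounded i k : bounded_signal (fun t => w i t k 0).
Proof.
apply/bounded_entry/bounded_enorm_sqr.
exists ((kappa i)^-1 * (2 * rho i * phi (r ^+ 2))) => t t0.
rewrite ger0_norm ?dotvv_ge0// ler_pdivlMl//.
exact/filter_energy_le/ltW.
Qed.

Lemma velocity_enorm_bounded i : bounded_signal (fun t => enorm (v i t)).
Proof.
have [l l0 vl] := passive_coercive (pass i).
apply: bounded_enorm_sqr; exists (l^-1 * (2 * rho i * V 0)) => t t0.
have t0' := ltW t0; have rt := in_range_forever t0'.
rewrite ger0_norm ?dotvv_ge0// ler_pdivlMl// -sqr_enorm (le_trans (vl t t0'))//.
rewrite -ler_pdivrMl ?mulr_gt0//.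
have [A _ _] := storage_ge i t0' rt.
apply: (le_trans A); apply: (le_trans (storage_le_lyapunov i t0' rt)).
by apply: lyapunov_decreasing; rewrite lexx.
Qed.

Lemma velocity_bounded i k : bounded_signal (fun t => v i t k 0).
Proof. exact/bounded_entry/velocity_enorm_bounded. Qed.

Lemma sqdist_bounded i j : edge i j -> bounded_signal (d i j).
Proof.
move=> eij; exists (r ^+ 2) => t t0.
by rewrite ger0_norm ?sqdist_ge0//; exact: in_range_forever (ltW t0) _ _ eij.
Qed.

Lemma diff_bounded i j k : edge i j -> bounded_signal (fun t => (x i t - x j t) k 0).
Proof. by move=> eij; apply/bounded_entry/bounded_enorm_sqr/sqdist_bounded. Qed.

Lemma velocity_diff_bounded i j k : bounded_signal (fun t => (v i t - v j t) k 0).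
Proof.
rewrite (_ : (fun t => _) = fun t => v i t k 0 - v j t k 0).
  by apply: bounded_signalB; exact: velocity_bounded.
by apply/funext => t; rewrite !mxE.
Qed.

Lemma dphi_bounded i j : edge i j -> bounded_signal (fun t => dphi (d i j t)).
Proof.
move=> eij; exists sigma => t t0.
have /andP[a0 b0] := dphi_lt (in_rangeP (in_range_forever (ltW t0)) eij).
by rewrite ger0_norm// ltW.
Qed.

Lemma coupling_bounded i k : bounded_signal (fun t => G i t k 0).
Proof.
rewrite (_ : (fun t => _) = fun t =>
  \sum_(j | edge i j) 2 * dphi (d i j t) * (x i t - x j t) k 0); last first.
  by apply/funext => t; exact: couplingE.
apply: bounded_signal_sum => j eij; apply: bounded_signalM; last exact: diff_bounded.
exact/bounded_signalZ/dphi_bounded.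
Qed.

Lemma input_bounded i k : bounded_signal (fun t => u i t k 0).
Proof.
have [B hB] := bounded_signalB (bounded_signalZ (- rho i) (coupling_bounded i k))
  (bounded_signalZ (kappa i) (filter_rate_bounded i k)).
by exists B => t t0; rewrite control_appliedE// hB.
Qed.

Lemma acceleration_bounded i k : bounded_signal (fun t => dv i t k 0).
Proof.
have [a [b hab]] := passive_acceleration (pass i).
apply: bounded_entry.
apply: (bounded_signal_le (b := fun t => a * enorm (u i t) + b * (enorm (v i t) * enorm (v i t)))).
  apply: bounded_signalD; first exact/bounded_signalZ/bounded_enorm/input_bounded.
  by apply/bounded_signalZ/bounded_signalM; exact: velocity_enorm_bounded.
by move=> t t0; rewrite (ger0_norm (enorm_ge0 _)) -expr2 hab.
Qed.

Context (curvature : exists B : R, forall z : R, 0 <= z <= r ^+ 2 -> `|ddphi z| <= B).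

Lemma coupling_lipschitz i k : exists L : R, forall s t, 0 < s <= t ->
  `|G i t k 0 - G i s k 0| <= L * (t - s).
Proof.
pose dG t := \sum_(j | edge i j)
  (2 * dphi (d i j t) * (v i t - v j t) k 0
   + (x i t - x j t) k 0 *
     (2 * (ddphi (d i j t) * (2 * dotv (x i t - x j t) (v i t - v j t))))).
have [L dGL] : bounded_signal dG.
  apply: bounded_signal_sum => j eij; apply: bounded_signalD.
    apply: bounded_signalM; last exact: velocity_diff_bounded.
    exact/bounded_signalZ/dphi_bounded.
  apply: bounded_signalM; first exact: diff_bounded.
  apply/bounded_signalZ/bounded_signalM.
    have [B hB] := curvature; exists B => t t0; apply: hB.
    exact: in_rangeP (in_range_forever (ltW t0)) eij.
  apply/bounded_signalZ/bounded_dotv => l; first exact: diff_bounded.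
  exact: velocity_diff_bounded.
exists L; apply: lipschitz_derive dGL => t t0.
rewrite (_ : (fun t => G i t k 0) = fun t =>
  \sum_(j | edge i j) 2 * dphi (d i j t) * (x i t - x j t) k 0); last first.
  by apply/funext => s; exact: couplingE.
apply: is_derive_big_sum => j eij.
have /is_derive_mxP /(_ k 0) dx := is_derive_diff i j t0.
have range_t := in_rangeP (in_range_forever (ltW t0)) eij.
have ddphi_t := @is_derive1_comp _ dphi (d i j) t _ _ (dphi_d range_t)
  (is_derive_sqdist i j t0).
exact: is_deriveM (is_deriveZ 2 ddphi_t) dx.
Qed.

(** The dissipation is the decay rate of the Lyapunov function, and is
    Lipschitz because the filter rates and their derivatives are bounded. *)
Lemma filter_rate_vanishing i k : vanishing (fun t => w i t k 0).
Proof.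
have V_ge0 t : 0 <= t -> 0 <= V t.
  by move=> t0; apply: sumr_ge0 => j _; apply: storage_ge0 => //; exact: in_range_forever.
have [l Vl] := nonincreasing_converges lyapunov_decreasing V_ge0.
pose c j := (rho j)^-1 * (kappa j * zeta j).
have c0 j : 0 < c j by rewrite !mulr_gt0 ?invr_gt0.
pose D t := \sum_j c j * dotv (w j t) (w j t).
have DE t : dissipation t = D t.
  by apply: eq_bigr => j _; rewrite /c !mulrA.
pose dD t := \sum_j c j * (2 * dotv (w j t) (v j t - zeta j *: w j t)).
have [L dDL] : bounded_signal dD.
  apply: bounded_signal_sum => j _; apply/bounded_signalZ/bounded_signalZ.
  apply: bounded_dotv => m; first exact: filter_rate_bounded.
  have [B hB] := bounded_signalB (velocity_bounded j m)
    (bounded_signalZ (zeta j) (filter_rate_bounded j m)).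
  exists B => t t0; have := hB t t0; move: (w j t) => y; by rewrite !mxE.
have dDd (t : R) : 0 < t -> is_derive t 1 D (dD t).
  move=> t0; apply: is_derive_big_sum => j _.
  have dw := is_derive_filter_rate j t0.
  apply: (is_derive_eq (is_deriveZ (c j) (is_derive_dotv dw dw))).
  by rewrite /GRing.scale /= (dotvC (v j t - _)) mulr_natl mulr2n.
have DL := lipschitz_derive dDd dDL.
have : vanishing (fun t => - D t).
  apply: (@Barbalat _ V _ (fun=> 0) l L) Vl _ (@vanishing0 R).
    by move=> t t0; rewrite addr0 -DE; exact: is_derive_lyapunov_dissipation.
  by move=> s t st; rewrite -opprD normrN; exact: DL.
move=> /(vanishingZ (- (c i)^-1)) D0.
apply/vanishing_entry/vanishing_enorm; apply: vanishing_le D0 _ => t t0.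
rewrite mulrNN ger0_norm ?dotvv_ge0// ler_pdivlMl// /D (bigD1 i)//= lerDl.
by apply: sumr_ge0 => j _; rewrite mulr_ge0 ?dotvv_ge0 ?ltW.
Qed.

(** The rate of the vanishing signal [w] is [v] up to a multiple of [w]. *)
Lemma velocity_vanishing i k : vanishing (fun t => v i t k 0).
Proof.
have [L vL] : exists L : R, forall s t, 0 < s <= t ->
    `|v i t k 0 - v i s k 0| <= L * (t - s).
  have [L dvL] := acceleration_bounded i k; exists L.
  apply: lipschitz_derive dvL => t t0.
  by have /is_derive_mxP := passive_v (pass i) t0; exact.
apply: (@Barbalat _ (fun t => w i t k 0) _ (fun t => - zeta i * w i t k 0) 0 L) => //.
- move=> t t0; have /is_derive_mxP /(_ k 0) := is_derive_filter_rate i t0.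
  move/is_derive_eq; apply; move: (w i t) => y; by rewrite !mxE mulNr.
- exact: filter_rate_vanishing.
- exact/vanishingZ/filter_rate_vanishing.
Qed.

Lemma velocity_enorm_vanishing i : vanishing (fun t => enorm (v i t)).
Proof.
apply: vanishing_enorm; apply: vanishing_dotv => k; first exact: velocity_bounded.
exact: velocity_vanishing.
Qed.

(** The momentum vanishes with the velocity, and its derivative is the
    coupling force up to terms that vanish with the velocity and the filter
    rate. *)
Lemma coupling_vanishing i k : vanishing (fun t => G i t k 0).
Proof.
have [l pl] := passive_momentum (pass i).
have [c ec] := passive_remainder (pass i).
have [L GL] := coupling_lipschitz i k.
apply: (@vanishingZK _ (- rho i)); first by rewrite oppr_eq0 gt_eqF.
apply: (@Barbalat _ (fun t => p i t k 0) _
  (fun t => - kappa i * w i t k 0 + err i t k 0) 0 (rho i * L)).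
- move=> t t0; have /is_derive_mxP /(_ k 0) := passive_p (pass i) t0.
  by move/is_derive_eq; apply; rewrite mxE control_appliedE// !mulNr addrA.
- apply: vanishing_entry; apply: vanishing_le (vanishingZ l (velocity_enorm_vanishing i)) _.
  by move=> t t0; rewrite ger0_norm ?enorm_ge0// pl// ltW.
- move=> s t st; rewrite !mulNr -opprD normrN -mulrBr normrM gtr0_norm//.
  by rewrite -mulrA ler_wpM2l ?GL// ltW.
- apply: vanishingD; first exact/vanishingZ/filter_rate_vanishing.
  have v2 := bounded_vanishingM (velocity_enorm_bounded i) (velocity_enorm_vanishing i).
  apply: vanishing_le (vanishingZ c v2) _ => t t0.
  by rewrite -expr2 ec.
Qed.

Context (connected : forall i j, connect edge i j).
Context (attraction : forall eps : R, 0 < eps -> exists2 del : R, 0 < del &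
  forall z, eps <= z <= r ^+ 2 -> del <= dphi z * z).

Lemma connect_closed (P : 'I_N -> 'I_N -> Prop) :
  (forall i, P i i) -> (forall i j k, P i j -> P j k -> P i k) ->
  (forall i j, edge i j -> P i j) -> forall i j, P i j.
Proof.
move=> Prefl Ptrans Pedge i j; have /connectP[s + ->] := connected i j.
elim: s i => [|k s IHs] i //= /andP[eik /IHs].
exact/Ptrans/Pedge.
Qed.

(** The configurations themselves may drift; only their differences are
    controlled, along the paths of the connected graph. *)
Lemma diff_from_bounded i j k : bounded_signal (fun t => (x i t - x j t) k 0).
Proof.
move: i j; apply: connect_closed => [i|i j l xij xjl|i j]; last exact: diff_bounded.
- by exists 0 => t _; rewrite subrr mxE normr0.
- have [B hB] := bounded_signalD xij xjl; exists B => t t0.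
  have := hB t t0; rewrite (_ : _ + _ = (x i t - x l t) k 0)//.
  by rewrite !mxE; ring.
Qed.

(** The couplings sum to zero, so that their work may be computed on the
    configurations relative to that of [i], which stay bounded. Hence it
    vanishes with the couplings; being the sum of the nonnegative terms
    [dphi d * d], it makes each of them vanish, and with it the distance. *)
Lemma sqdist_vanishing i j : edge i j -> vanishing (d i j).
Proof.
move=> eij.
pose S t := \sum_k \sum_(l | edge k l) dphi (d k l t) * d k l t.
have SE t : S t = \sum_k dotv (x k t - x i t) (G k t).
  rewrite (coupling_power (fun k => x k t - x i t)).
  apply: eq_bigr => k _; apply: eq_bigr => l _; congr (_ * dotv _ _).
  by rewrite opprB addrA subrK.
have S0 : vanishing S.
  rewrite (_ : S = fun t => \sum_k dotv (x k t - x i t) (G k t)); last first.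
    exact/funext.
  apply: vanishing_sum => k _; apply: vanishing_dotv => l.
    exact: diff_from_bounded.
  exact: coupling_vanishing.
have term_ge0 k l t : 0 < t -> edge k l -> 0 <= dphi (d k l t) * d k l t.
  move=> t0 ekl; rewrite mulr_ge0 ?sqdist_ge0//.
  by have /andP[] := dphi_lt (in_rangeP (in_range_forever (ltW t0)) ekl).
have dd0 : vanishing (fun t => dphi (d i j t) * d i j t).
  apply: vanishing_le S0 _ => t t0; rewrite ger0_norm ?term_ge0//.
  rewrite /S (bigD1 i)//= (bigD1 j)//= -addrA lerDl addr_ge0//.
    by apply: sumr_ge0 => l /andP[eil _]; exact: term_ge0.
  by apply: sumr_ge0 => k _; apply: sumr_ge0 => l ekl; exact: term_ge0.
apply/cvgr0Pnorm_lt => eps eps0; have [del del0 hdel] := attraction eps0.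
move/cvgr0Pnorm_lt : dd0 => /(_ _ del0) dd0; near=> t.
have t0 : 0 < t by near: t; apply: nbhs_pinfty_gt; exact: num_real.
have : `|dphi (d i j t) * d i j t| < del by near: t; exact: dd0.
rewrite !ger0_norm ?sqdist_ge0 ?term_ge0// => small.
rewrite ltNge; apply/negP => big; move: small; rewrite ltNge hdel// big/=.
exact: in_range_forever (ltW t0) _ _ eij.
Unshelve. all: by end_near. Qed.

Lemma consensus i j k : vanishing (fun t => (x i t - x j t) k 0).
Proof.
move: i j; apply: connect_closed => [i|i j l xij xjl|i j eij].
- rewrite (_ : (fun t => _) = fun=> 0); first exact: vanishing0.
  by apply/funext => t; rewrite subrr mxE.
- rewrite (_ : (fun t => _) = fun t => (x i t - x j t) k 0 + (x j t - x l t) k 0).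
    exact: vanishingD.
  by apply/funext => t; rewrite !mxE; ring.
- exact/vanishing_entry/vanishing_enorm/sqdist_vanishing.
Qed.

End Network.

(** * Connectivity-preserving coordination *)

Lemma cvg_mx (R : realType) (T : Type) (F : set_system T) {FF : Filter F} m n
    (f : T -> 'M[R]_(m, n)) (l : 'M[R]_(m, n)) :
  (forall i j, f t i j @[t --> F] --> l i j) -> f t @[t --> F] --> l.
Proof.
move=> fl; apply/cvgrPdist_le => e e0; near=> t.
rewrite /Num.Def.normr/= mx_normrE (bigmax_le _ (ltW e0))//= => ij _.
rewrite !mxE; move: ij; near: t; apply: filter_forall => -[i j] /=.
exact: ((cvgrPdist_le _ _).1 (fl i j)).
Unshelve. all: by end_near. Qed.

Lemma sum_neighbours (R : realType) (V : nmodType) N (E : R -> rel 'I_N) i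
    (F : 'I_N -> V) :
  \sum_(j in neighbours E 0 i) F j = \sum_(j | E 0 i j) F j.
Proof. by apply: eq_bigl => j; rewrite inE. Qed.

Theorem theorem1 (R : realType) (N n : nat) (sys : 'I_N -> el_system R n)
    (fbar gamma : 'I_N -> 'cV[R]_n)
    (E : R -> rel 'I_N) (r eps : R)
    (Psi : R -> R -> R) (sigma nu : R -> R)
    (Q : R) (rho zeta kappa : 'I_N -> R)
    (q dq ddq f xhat : 'I_N -> R -> 'cV[R]_n)
    (lambda20 : 'I_N -> R) :
  let x := fun (i : 'I_N) (t : R) => fkin (sys i) (q i t) in
  let psi := pot Psi Q in
  (forall i, standing_properties (sys i)) ->
  (forall i, gravity_bounded (sys i) (gamma i) (fbar i)) ->
  communication E r eps x ->
  potential n r Psi sigma nu ->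
  0 < Q ->
  (forall i, [/\ 0 < rho i, 0 < zeta i & 0 < kappa i]) ->
  (forall i, el_motion (sys i) (q i) (dq i) (ddq i) (f i)) ->
  (forall i, filter_motion (zeta i) (xhat i) (x i)) ->
  (forall i, bounded_actuation (fbar i)
     (output_feedback sys E Psi Q rho kappa zeta q xhat x i) (f i)) ->
  (forall i k,
     2 * #|neighbours E 0 i|%:R * rho i * sigma Q * r
     + Num.sqrt (2 * rho i * kappa i * psi r) + gamma i k 0 <= fbar i k 0) ->
  (forall i, max_eigenvalue (inertia (sys i) (q i 0)) (lambda20 i)) ->
  2^-1 * \sum_i (lambda20 i / rho i * enorm (dq i 0) ^+ 2
                 + \sum_(j in neighbours E 0 i) psi (enorm (x i 0 - x j 0)))
    < psi r ->
  (forall i j, E 0 i j -> forall t : R, 0 <= t -> enorm (x i t - x j t) < r) /\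
  (forall i j, (fun t => x i t - x j t) @ +oo --> (0 : 'cV[R]_n)).
Proof.
move=> x psi sp grav comm pP Q0 gains em filt act gain_bound maxeig init.
have r0 := comm_radius_gt0 comm.
have rho0 i : 0 < rho i by have [] := gains i.
have zeta0 i : 0 < zeta i by have [] := gains i.
have kappa0 i : 0 < kappa i by have [] := gains i.
have edge_sym : symmetric (E 0) by have [] := comm_undirected comm (lexx 0).
pose phi := Psi Q; pose dphi := (phi^`())%classic; pose ddphi := (dphi^`())%classic.
have [del del0 smooth] := smooth_potential pP Q0.
have smooth_in z : 0 <= z <= r ^+ 2 -> is_derive z 1 phi (dphi z) /\
    is_derive z 1 dphi (ddphi z).
  move=> /andP[z0 zr]; have [|//] := smooth z.
  by rewrite (lt_le_trans _ z0) ?oppr_lt0//= ltr_pwDr.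
have phi_d z zr := (smooth_in z zr).1.
have dphi_d z zr := (smooth_in z zr).2.
have phi_ge0 := potential_ge0 pP Q0 r0.
have dphi_lt z : 0 <= z <= r ^+ 2 -> 0 <= dphi z < sigma Q.
  move=> /andP[z0 zr]; rewrite -(sqr_sqrtr z0); apply: (pot_derive pP Q0).
  by rewrite sqrtr_ge0 -(ger0_norm (ltW r0)) -sqrtr_sqr ler_wsqrtr.
pose v i t := jac (sys i) (q i t) *m dq i t.
pose p i t := task_inertia (sys i) (q i t) *m v i t.
pose u i t := f i t - task_gravity (sys i) (q i t).
have pass i : passive_motion (x i) (v i)
    (fun t => jac_dot (sys i) (q i t) (dq i t) *m dq i t
              + jac (sys i) (q i t) *m ddq i t)
    (p i) (fun t => (task_coriolis (sys i) (q i t) (dq i t))^T *m v i t) (u i).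
  exact: (passive_el_motion (sp i) (em i)).
pose w := filter_rate x xhat zeta.
have gradE i (t : R) : in_range (E 0) r x t ->
    \sum_(j in neighbours E 0 i) grad_pot Psi Q (x i t) (x j t)
    = coupling (E 0) dphi x i t.
  move=> rt; rewrite sum_neighbours; apply: eq_bigr => j eij.
  have [dphi_t _] := (phi_d _ (in_rangeP rt eij)).
  by rewrite grad_potE sqr_enorm.
have unsaturated i (t : R) : 0 <= t -> in_range (E 0) r x t ->
    kappa i * dotv (w i t) (w i t) <= 2 * rho i * phi (r ^+ 2) ->
    u i t = - (rho i *: coupling (E 0) dphi x i t) - kappa i *: w i t.
  move=> t0 rt wt; have [_ applied] := act i t t0.
  rewrite /u applied; first by rewrite /output_feedback addrK gradE.
  (* The three terms of the control are bounded by those of the gain condition. *)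
  move=> k; apply: le_trans (gain_bound i k); rewrite /output_feedback gradE//.
  have /(_ _ (motion_region (em i) t0)) gk := (grav i k).1.
  have Gk := coupling_le r0 dphi_lt i k rt.
  have wk : kappa i * `|w i t k 0| <= Num.sqrt (2 * rho i * kappa i * psi r).
    rewrite -(ger0_norm (mulr_ge0 (ltW (kappa0 i)) (normr_ge0 (w i t k 0)))).
    rewrite -sqrtr_sqr ler_wsqrtr// exprMn expr2 -mulrA.
    rewrite (_ : 2 * rho i * kappa i * psi r = kappa i * (2 * rho i * psi r)).
      rewrite ler_wpM2l ?(ltW (kappa0 i))//; apply: le_trans wt.
      rewrite ler_wpM2l ?(ltW (kappa0 i))// -sqr_enorm ler_pXn2r ?nnegrE//.
        exact: ler_abs_enorm.
      exact: enorm_ge0.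
    by ring.
  have Ei : #|E 0 i| = #|neighbours E 0 i| by apply: eq_card => j; rewrite inE.
  rewrite Ei in Gk.
  rewrite mxE -/(w i t); apply: le_trans (ler_normD _ _) _; apply: lerD => //.
  have -> : (- (rho i *: coupling (E 0) dphi x i t) - kappa i *: w i t) k 0
    = - (rho i * coupling (E 0) dphi x i t k 0) - kappa i * w i t k 0.
    by move: (coupling _ _ _ _ _) (w i t) => g y; rewrite !mxE.
  apply: le_trans (ler_normB _ _) _; rewrite normrN !normrM.
  rewrite (gtr0_norm (rho0 i)) (gtr0_norm (kappa0 i)).
  apply: lerD => //; rewrite (_ : _ * sigma Q * r =
    rho i * (2 * #|neighbours E 0 i|%:R * sigma Q * r)); last by ring.
  by rewrite ler_wpM2l// ltW.
have range0 i j : E 0 i j -> sqdist x i j 0 < r ^+ 2.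
  move=> eij; rewrite /sqdist -enorm_lt_sqr ?(ltW r0)//.
  apply: le_lt_trans (comm_margin comm eij) _.
  by have /andP[e0 _] := comm_eps comm; rewrite gtrBl.
(* The filters contribute nothing at the initial time. *)
have V0 : lyapunov (E 0) phi x v p xhat rho zeta kappa 0 < phi (r ^+ 2).
  apply: le_lt_trans init; rewrite mulr_sumr; apply: ler_sum => i _.
  rewrite /storage (filter_rate0 zeta0 filt) dotv0 !mulr0 addr0 mulrDr.
  apply: lerD; last first.
    rewrite sum_neighbours ler_pM2l ?invr_gt0//; apply: ler_sum => j _.
    by rewrite /psi /pot sqr_enorm.
  rewrite (energyE (sp i) (em i) (lexx 0)).
  have -> : 2^-1 * (lambda20 i / rho i * enorm (dq i 0) ^+ 2) =
      (2 * rho i)^-1 * (lambda20 i * enorm (dq i 0) ^+ 2).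
    by field; rewrite gt_eqF.
  rewrite ler_wpM2l ?invr_ge0 ?mulr_ge0 ?(ltW (rho0 i))//.
  exact: qform_le_max_eigenvalue (inertia_sym (sp i) _) (maxeig i).
split=> [i j eij t t0|i j].
  rewrite enorm_lt_sqr ?(ltW r0)//.
  have [links _] := operating_domain_invariant edge_sym r0 phi_d phi_ge0 rho0 zeta0
    kappa0 pass filt unsaturated range0 V0 t0.
  exact: links.
apply: cvg_mx => k l; rewrite ord1 mxE.
apply: (consensus edge_sym r0 phi_d dphi_d phi_ge0 dphi_lt rho0 zeta0 kappa0 pass
  filt unsaturated range0 V0 (curvature_bounded pP Q0)).
- exact: comm_connected comm.
- exact: (attraction_lower_bound pP Q0 r0 k).
Qed.
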